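(* Let $\{\mu_\theta\}_{\theta\in\Theta}$ be a family of Borel probability measures on $\mathbb{R}^d$ and let $\mu_{\mathrm{mix}}$ be its mixture with respect to a mixing probability measure $m$ on $\Theta$. Suppose that the measures $\mu_\theta$ satisfy the convex log-Sobolev inequality with uniformly bounded constants: $$C_\Theta:=\sup_{\theta\in\Theta}C_{\mathrm{LS}}^{\mathrm{conv}}(\mu_\theta)<\infty ,$$ and that $\int_{\mathbb{R}^d}\exp(s|x|)\,d\mu_\theta(x)<\infty$ for all $\theta\in\Theta$ and $s>0$. Suppose moreover that $$D_\Theta:=\sup_{\theta,\theta'\in\Theta}\overline{\mathcal{T}}_2(\mu_\theta|\mu_{\theta'})<\infty .$$ Then $\mu_{\mathrm{mix}}$ satisfies the convex log-Sobolev inequality and $$C_{\mathrm{LS}}^{\mathrm{conv}}(\mu_{\mathrm{mix}})\le\max\{8C_\Theta,\,16D_\Theta\}.$$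
   Context: Mixture: $(\Theta,\mathfrak{M},m)$ is a probability space, for every Borel set $A\subset\mathbb{R}^d$ the map $\theta\mapsto\mu_\theta(A)$ is measurable, and $\mu_{\mathrm{mix}}(A):=\int_\Theta \mu_\theta(A)\,dm(\theta)$ for Borel $A\subset\mathbb{R}^d$. $|\cdot|$ is the Euclidean norm. $\mathrm{Ent}_\mu(g):=\int g\log g\,d\mu-\int g\,d\mu\,\log(\int g\,d\mu)$ for $g\ge0$. A probability measure $\mu$ on $\mathbb{R}^d$ satisfies the convex log-Sobolev inequality with constant $C\in(0,\infty)$ if $$\mathrm{Ent}_\mu(e^f)\le\frac C2\int_{\mathbb{R}^d}|\nabla f|^2e^f\,d\mu$$ for all convex functions $f:\mathbb{R}^d\to\mathbb{R}$ which are $C^1$, Lipschitz and bounded from below. $C_{\mathrm{LS}}^{\mathrm{conv}}(\mu)$ is the optimal such constant (infimum; $+\infty$ if there is none). Convention: an estimate $A\le B$ means that if $B<\infty$, then $A$ is well defined and the inequality holds. Weak quadratic transport cost: for probability measures $\mu_1,\mu_2$ on $\mathbb{R}^d$, $\mu_2$ with finite first moment, $$\overline{\mathcal{T}}_2(\mu_2|\mu_1):=\inf_\pi\int_{\mathbb{R}^d}\tfrac12\Bigl|x-\int_{\mathbb{R}^d}y\,p_x(dy)\Bigr|^2\mu_1(dx),$$ where the infimum is over all couplings $\pi$ of $\mu_1$ and $\mu_2$, and $p_x$ is defined ($\mu_1$-a.s.) by $\pi(dx\,dy)=p_x(dy)\mu_1(dx)$. *)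

(* Defs.v *)
From HB Require Import structures.
From mathcomp Require Import all_boot all_order all_algebra.
From mathcomp Require Import all_classical all_reals all_analysis.
From mathcomp Require Import measurable_realfun.

Set Implicit Arguments.
Unset Strict Implicit.
Unset Printing Implicit Defensive.

Import Order.TTheory GRing.Theory Num.Theory.
Import numFieldNormedType.Exports.

Local Open Scope classical_set_scope.
Local Open Scope ring_scope.
Local Open Scope ereal_scope.

(* R^d is 'rV[R]_d with its Borel sigma-algebra. The topology of 'rV[R]_d comes
   from the sup norm `|x|, hence is the usual one. *)
HB.instance Definition _ (R : realType) (d : nat) :=
  @isMeasurable.Build (sigma_display (@open 'rV[R]_d)) 'rV[R]_d
    <<s @open 'rV[R]_d >> (@sigma_algebra0 _ setT _) (@sigma_algebraC _ _)
    (@sigma_algebra_bigcup _ setT _).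

(* `|x| on 'rV[R]_d is the sup norm, not the Euclidean one. *)
Definition enorm (R : realType) (d : nat) (x : 'rV[R]_d) : R :=
  Num.sqrt (\sum_(i < d) (x 0 i) ^+ 2)%R.

Definition gradient (R : realType) (d : nat) (f : 'rV[R]_d -> R)
    (x : 'rV[R]_d) : 'rV[R]_d :=
  (\row_(i < d) 'D_(delta_mx 0 i) f x)%R.

Definition C1 (R : realType) (d : nat) (f : 'rV[R]_d -> R) : Prop :=
  (forall x, differentiable f x) /\ continuous (gradient f).

Definition euclidean_lipschitz (R : realType) (d : nat) (f : 'rV[R]_d -> R) :
    Prop :=
  exists L : R, forall x y, (`|f x - f y| <= L * enorm (x - y))%R.

Definition bounded_from_below (R : realType) (T : Type) (f : T -> R) : Prop :=
  exists c : R, forall x, (c <= f x)%R.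

Section entropy.
Context (R : realType) (d : measure_display) (T : measurableType d).
Variables (mu : probability T R) (g : T -> R).

Definition ent : \bar R :=
  \int[mu]_x (g x * ln (g x))%:E
  - (\int[mu]_x (g x)%:E) * lne (\int[mu]_x (g x)%:E).

(* For g >= 0 both integrals always exist in ]-oo, +oo], as t ln t >= - 1/e; so
   the entropy is well defined unless it reads +oo - +oo. That case has to be
   excluded by hand, since (+oo - +oo)%E is -oo by convention. *)
Definition ent_defined : bool :=
  \int[mu]_x (g x * ln (g x))%:E
  +? - ((\int[mu]_x (g x)%:E) * lne (\int[mu]_x (g x)%:E)).

End entropy.

(* An estimate A <= B between possibly infinite or undefined quantities means:
   if B is finite, then A is well defined and the inequality holds. *)
Definition convex_LSI (R : realType) (d : nat) (mu : probability 'rV[R]_d R)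
    (C : R) : Prop :=
  (0 < C)%R /\
  forall f : 'rV[R]_d -> R,
    convex_function setT f -> C1 f -> euclidean_lipschitz f ->
    bounded_from_below f ->
    let rhs :=
      (C / 2)%:E * \int[mu]_x (enorm (gradient f x) ^+ 2 * expR (f x))%:E in
    rhs < +oo ->
    ent_defined mu (expR \o f) /\ ent mu (expR \o f) <= rhs.

Definition C_LS_conv (R : realType) (d : nat) (mu : probability 'rV[R]_d R) :
    \bar R :=
  ereal_inf [set C%:E | C in [set C : R | convex_LSI mu C]].

Definition is_mixture (R : realType) (d : nat) (dT : measure_display)
    (Theta : measurableType dT) (m : probability Theta R)
    (mu : Theta -> probability 'rV[R]_d R) (mumix : probability 'rV[R]_d R) :
    Prop :=
  (forall A, measurable A -> measurable_fun setT (fun t => mu t A)) /\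
  (forall A, measurable A -> mumix A = \int[m]_t mu t A).

Definition is_coupling (R : realType) (d : nat)
    (mu1 mu2 : probability 'rV[R]_d R)
    (pi : probability ('rV[R]_d * 'rV[R]_d)%type R) : Prop :=
  forall A, measurable A ->
    pi (A `*` setT) = mu1 A /\ pi (setT `*` A) = mu2 A.

(* pi(dx dy) = p_x(dy) mu1(dx) *)
Definition is_disintegration (R : realType) (d : nat)
    (mu1 : probability 'rV[R]_d R)
    (pi : probability ('rV[R]_d * 'rV[R]_d)%type R)
    (p : R.-pker 'rV[R]_d ~> 'rV[R]_d) : Prop :=
  forall A B, measurable A -> measurable B ->
    pi (A `*` B) = \int[mu1]_(x in A) p x B.

Definition barycenter (R : realType) (d : nat)
    (nu : {measure set 'rV[R]_d -> \bar R}) : 'rV[R]_d :=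
  (\row_(i < d) \int[nu]_y (y 0 i))%R.

(* Every coupling on R^d has a disintegration, unique mu1-a.s.; the cost does
   not depend on the version, so the infimum over (pi, p) is the one over pi.
   Meaningful when mu2 has a finite first moment: then the barycenter of p_x
   exists for mu1-a.e. x. *)
Definition weak_transport_cost (R : realType) (d : nat)
    (mu2 mu1 : probability 'rV[R]_d R) : \bar R :=
  ereal_inf [set c | exists pi p,
    [/\ is_coupling mu1 mu2 pi, is_disintegration mu1 pi p &
        c = \int[mu1]_x (2^-1 * enorm (x - barycenter (p x)) ^+ 2)%:E]].

(* Main.v *)
From HB Require Import structures.
Require Import Defs.
From mathcomp Require Import all_boot all_order all_algebra.
From mathcomp Require Import all_classical all_reals all_analysis.
From mathcomp Require Import measurable_realfun.
From mathcomp Require Import ring lra.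

Import Order.TTheory GRing.Theory Num.Theory.
Import numFieldNormedType.Exports.

Set Implicit Arguments.
Unset Strict Implicit.
Unset Printing Implicit Defensive.

(** Write F(theta) for the integral of e^f against mu_theta.  For every t > 0 the
    entropy of e^f is at most the integral of s ln (s / t) - s + t at s = e^f.
    This integrand is nonnegative, so its integral against the mixture splits by
    Tonelli with no integrability assumption.  Against mu_theta it equals

      Ent(e^f) + F(theta) ln (F(theta) / t) - F(theta) + t,

    and the log-Sobolev inequality of mu_theta controls the first term.  With t
    the infimum of F, the rest depends only on how large F(theta) / F(theta') can
    be.  By [compare_mass] this ratio is controlled by u, the average of
    |grad f|^2 under the probability proportional to e^f mu_theta.  The weak
    transport cost enters through [transport_subgradient]: a nonnegative convex
    phi with subgradient q satisfies, for all r > 0,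

      int phi dmu_theta <= int phi dmu_theta' + r/2 int |q|^2 dmu_theta + D/r.

    If u is small, this is applied to e^(f/2): the squared slope of that function
    is |grad f|^2 e^f / 4, already the right density, and the log-Sobolev
    inequality bounds int e^(f/2) dmu_theta from below ([ln_expint_half]).

    If u is large, a constant factor is affordable.  At least a third of the mass
    of e^f mu_theta lies where |grad f| < M, with M^2 = 3u/2.  The supremum of the
    tangents of f at such points has slope at most M, lies below f and agrees
    with f there; smoothed by a log-sum-exp it is a test function g
    ([tangent_minorants]).  Herbst's argument bounds int e^g dmu_theta by
    exp (int g dmu_theta + C M^2), transport moves int g to mu_theta', and
    Jensen's inequality for mu_theta' closes the chain ([compare_large]).

    Measured against the energy int |grad f|^2 e^f, the entropy of a component
    costs C/2, which is at most N/8 for N = max (4C, 8D), and in both regimes the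
    ratio term costs at most 7N/8 ([entropy_deficit_le]); the total N corresponds
    to the log-Sobolev constant 2N of the mixture.  The constants C_Theta and
    D_Theta are built from infima that need not be attained, so the argument runs
    for all C > C_Theta and D > D_Theta. *)

Local Open Scope classical_set_scope.
Local Open Scope ring_scope.

(** * Euclidean inner product and norm *)

Definition dotv (R : realType) (d : nat) (x y : 'rV[R]_d) : R :=
  \sum_(i < d) x 0 i * y 0 i.

Section euclidean.
Context (R : realType) (d : nat).
Implicit Types x y z : 'rV[R]_d.

Lemma dotvC x y : dotv x y = dotv y x.
Proof. by apply: eq_bigr => i _; rewrite mulrC. Qed.

Lemma dotvDr x y z : dotv x (y + z) = dotv x y + dotv x z.
Proof. by rewrite -big_split; apply: eq_bigr => i _; rewrite mxE mulrDr. Qed.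

Lemma dotvZr k x y : dotv x (k *: y) = k * dotv x y.
Proof. by rewrite mulr_sumr; apply: eq_bigr => i _; rewrite mxE mulrCA. Qed.

Lemma dotvNr x y : dotv x (- y) = - dotv x y.
Proof. by rewrite -scaleN1r dotvZr mulN1r. Qed.

Lemma dotvBr x y z : dotv x (y - z) = dotv x y - dotv x z.
Proof. by rewrite dotvDr dotvNr. Qed.

Lemma dotvZl k x y : dotv (k *: x) y = k * dotv x y.
Proof. by rewrite dotvC dotvZr dotvC. Qed.

Lemma dotvBl x y z : dotv (x - y) z = dotv x z - dotv y z.
Proof. by rewrite dotvC dotvBr !(dotvC z). Qed.

Lemma dotv_suml (I : Type) (s : seq I) (F : I -> 'rV[R]_d) y :
  dotv (\sum_(i <- s) F i) y = \sum_(i <- s) dotv (F i) y.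
Proof.
elim/big_rec2 : _ => [|i a b _ <-].
  by rewrite /dotv big1// => j _; rewrite mxE mul0r.
by rewrite dotvC dotvDr !(dotvC y).
Qed.

Lemma dotv_delta x (i : 'I_d) : dotv x (delta_mx 0 i) = x 0 i.
Proof.
rewrite /dotv (bigD1 i)//= mxE !eqxx mulr1 big1 ?addr0// => j ji.
by rewrite mxE (negbTE ji) andbF mulr0.
Qed.

Lemma enorm_sqr x : enorm x ^+ 2 = dotv x x.
Proof. by rewrite sqr_sqrtr// sumr_ge0// => i _; rewrite sqr_ge0. Qed.

Lemma enorm_ge0 x : 0 <= enorm x.
Proof. exact: sqrtr_ge0. Qed.

Lemma enormZ k x : enorm (k *: x) = `|k| * enorm x.
Proof.
apply/eqP; rewrite -(@eqrXn2 _ 2)// ?mulr_ge0 ?enorm_ge0//.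
by rewrite exprMn !enorm_sqr dotvZl dotvZr real_normK ?num_real// mulrA.
Qed.

Lemma enormN x : enorm (- x) = enorm x.
Proof. by rewrite -scaleN1r enormZ normrN1 mul1r. Qed.

Lemma enorm0 : enorm (0 : 'rV[R]_d) = 0.
Proof. by rewrite -(scale0r 0) enormZ normr0 mul0r. Qed.

Lemma dotv_young (t : R) x y : 0 < t ->
  dotv x y <= t / 2 * enorm x ^+ 2 + t^-1 * (2^-1 * enorm y ^+ 2).
Proof.
move=> t0; rewrite !enorm_sqr /dotv !mulr_sumr -big_split ler_sum//= => i _.
rewrite -subr_ge0.
have -> : t / 2 * (x 0 i * x 0 i) + t^-1 * (2^-1 * (y 0 i * y 0 i))
   - x 0 i * y 0 i = (2 * t)^-1 * (t * x 0 i - y 0 i) ^+ 2.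
  by field; rewrite gt_eqF.
by rewrite mulr_ge0 ?sqr_ge0// invr_ge0 mulr_ge0// ltW.
Qed.

Lemma enorm_eq0 x : enorm x = 0 -> x = 0.
Proof.
move=> /(congr1 (fun t => t ^+ 2)); rewrite enorm_sqr expr0n/= => /eqP.
rewrite psumr_eq0 => [/allP h|i _]; last by rewrite -expr2 sqr_ge0.
apply/rowP => i; rewrite mxE; apply/eqP.
by have := h i (mem_index_enum i); rewrite mulf_eq0 orbb.
Qed.

Lemma dotv_le x y : dotv x y <= enorm x * enorm y.
Proof.
have [/enorm_eq0 ->|x0] := eqVneq (enorm x) 0.
  by rewrite enorm0 mul0r /dotv big1// => i _; rewrite mxE mul0r.
have [/enorm_eq0 ->|y0] := eqVneq (enorm y) 0.
  by rewrite enorm0 mulr0 /dotv big1// => i _; rewrite mxE mulr0.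
have /(dotv_young x y)/le_trans : 0 < enorm y / enorm x.
  by rewrite divr_gt0// lt_neqAle eq_sym enorm_ge0 ?x0 ?y0.
apply; rewrite le_eqVlt; apply/orP; left; apply/eqP; field.
by rewrite x0 y0.
Qed.

Lemma coord_le_norm x (i : 'I_d) : `|x 0 i| <= `|x|.
Proof. by rewrite [leRHS]mx_normrE; apply: (le_bigmax _ _ (ord0, i)). Qed.

Lemma continuous_coord (i : 'I_d) : continuous (fun x : 'rV[R]_d => x 0 i).
Proof. exact: coord_continuous. Qed.

Lemma continuous_row (T : topologicalType) (p : T -> 'rV[R]_d) :
  (forall i, continuous (fun t => p t 0 i)) -> continuous p.
Proof.
move=> cp t A [P ptP PA].
have : \forall s \near t, forall i : 'I_d, P 0 i (p s 0 i).
  by apply: filter_forall => i; exact: cp (ptP 0 i).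
by apply: filterS => s Ps; apply: PA => i j; rewrite (ord1 i).
Qed.

Lemma continuous_dotv (T : topologicalType) (p q : T -> 'rV[R]_d) :
  continuous p -> continuous q -> continuous (fun t => dotv (p t) (q t)).
Proof.
move=> cp cq; apply: continuous_big => [|i _ t]; first exact: add_continuous.
apply: cvgM; [exact: (continuous_comp (cp t) (@continuous_coord i _))
             |exact: (continuous_comp (cq t) (@continuous_coord i _))].
Qed.

Lemma continuous_enorm (T : topologicalType) (p : T -> 'rV[R]_d) :
  continuous p -> continuous (fun t => enorm (p t)).
Proof.
move=> cp t; apply: (@continuous_comp _ _ _ _ (@Num.sqrt R)).
  have := continuous_dotv cp cp; rewrite /dotv => c; exact: c.
exact: sqrt_continuous.
Qed.

End euclidean.

(** * Convexity through subgradient fields *)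

Definition subgradient (R : realType) (d : nat) (f : 'rV[R]_d -> R)
    (p : 'rV[R]_d -> 'rV[R]_d) : Prop :=
  forall x y, f x + dotv (p x) (y - x) <= f y.

Section convex_calculus.
Context (R : realType) (d : nat).
Implicit Types (f : 'rV[R]_d -> R) (p : 'rV[R]_d -> 'rV[R]_d).

Lemma dotv_is_linear (x : 'rV[R]_d) : linear (dotv x : 'rV[R]_d -> R^o).
Proof. by move=> k u v; rewrite dotvDr dotvZr. Qed.

HB.instance Definition _ (x : 'rV[R]_d) :=
  GRing.isLinear.Build R 'rV[R]_d R^o *:%R (dotv x) (@dotv_is_linear x).

Lemma diff_gradient f x v : differentiable f x ->
  'd f x v = dotv (gradient f x) v.
Proof.
move=> df; rewrite {1}(row_sum_delta v) linear_sum dotvC.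
apply: eq_bigr => i _; rewrite linearZ/= mxE; congr (_ * _).
by rewrite deriveE.
Qed.

(** Convexity bounds the difference quotients of f in the direction y - x by
    f y - f x; the step then tends to 0 from the right. *)
Lemma convex_subgradient f : convex_function setT f ->
  (forall x, differentiable f x) -> subgradient f (gradient f).
Proof.
move=> cf df x y; rewrite -diff_gradient// -deriveE// addrC -lerBrDr.
have /cvg_dnbhs_at_right fr := @diff_derivable _ _ _ f x (y - x) (df x).
apply: (ler_cvg_to fr (cvg_cst _)).
have h1 : \forall h \near 0^'+, h <= 1 :> R by apply: nbhs_right_le.
near=> h.
have h0 : 0 < h by near: h; exact: nbhs_right_gt.
have hle1 : h <= 1 by near: h.
rewrite /= [_ *: _]/(_ * _) ler_pdivrMl// lerBlDr.
have -> : h *: (y - x) + x = h *: y + (1 - h) *: x.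
  by rewrite scalerBl scale1r scalerBr addrAC addrA.
have : f (h *: y + (1 - h) *: x) <= h * f y + (1 - h) * f x.
  by apply: (cf (Itv01 (ltW h0) hle1) y x); rewrite inE.
lra.
Unshelve. all: by end_near. Qed.

(** Average the two subgradient inequalities at the intermediate point: the
    linear terms cancel. *)
Lemma subgradient_convex f p : subgradient f p -> convex_function setT f.
Proof.
move=> fp; rewrite /convex_function => t x y _ _.
set s : R := t%:num; set z : 'rV[R]_d := s *: x + (1 - s) *: y.
suff : f z <= s * f x + (1 - s) * f y by [].
have sx : f z + dotv (p z) (x - z) <= f x := fp z x.
have sy : f z + dotv (p z) (y - z) <= f y := fp z y.
have s0 : 0 <= s by have : 0 <= t%:num by [].
have s1 : 0 <= 1 - s by rewrite subr_ge0; have : t%:num <= 1 by [].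
have : s * dotv (p z) (x - z) + (1 - s) * dotv (p z) (y - z) = 0.
  rewrite -!dotvZr -dotvDr.
  have -> : s *: (x - z) + (1 - s) *: (y - z) = 0; last first.
    by rewrite -(scale0r 0) dotvZr mul0r.
  rewrite !scalerBr addrACA -opprD -scalerDl subrKC scale1r.
  exact: subrr.
have := lerD (ler_wpM2l s0 sx) (ler_wpM2l s1 sy); lra.
Qed.

(** f (x + h) - f x - p x . h lies between 0 and (p (x + h) - p x) . h, which is
    o(h) when p is continuous.  Functions built from f are thus seen to be C^1
    from a formula for their slope, without differentiating anything. *)
Lemma subgradient_differentiable f p x : subgradient f p -> continuous p ->
  differentiable f x /\ gradient f x = p x.
Proof.
move=> fp cp.
have cl : continuous (dotv (p x) : 'rV[R]_d -> R^o).
  by apply: (@continuous_dotv _ _ _ (cst (p x)) id) => z;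
    [exact: cst_continuous|exact: cvg_id].
have H : f \o shift x = cst (f x) + (dotv (p x) : 'rV[R]_d -> R) +o_ 0 id.
  apply/eqaddoP => e e0.
  pose S (h : 'rV[R]_d) := \sum_(i < d) `|p (h + x) 0 i - p x 0 i|.
  have S0 : S 0 = 0 by rewrite /S add0r big1// => i _; rewrite subrr normr0.
  have cS : continuous S.
    apply: continuous_big => [|i _ h]; first exact: add_continuous.
    have c1 : {for h, continuous (fun h => p (h + x) 0 i)}.
      apply: (@continuous_comp _ _ _ (fun h => h + x) (fun y => p y 0 i)).
        exact: (cvgD cvg_id (cvg_cst _)).
      exact: (continuous_comp (cp (h + x)) (@continuous_coord R d i _)).
    exact: (cvg_norm (cvgB c1 (cvg_cst _))).
  have : \forall h \near (0 : 'rV[R]_d), S h <= e.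
    by apply: (cvgr_le _ (cS 0)); rewrite S0.
  apply: filterS => h he.
  have h1 : f x + dotv (p x) h <= f (h + x) by have := fp x (h + x); rewrite addrK.
  have h2 : f (h + x) - dotv (p (h + x)) h <= f x.
    by have := fp (h + x) x; rewrite opprD addrCA subrr addr0 dotvNr.
  rewrite /= ger0_norm; last by rewrite !fctE; lra.
  apply: (@le_trans _ _ (dotv (p (h + x) - p x) h)).
    by rewrite dotvBl !fctE; lra.
  apply: (@le_trans _ _ (S h * `|h|)); last by rewrite ler_wpM2r.
  rewrite mulr_suml; apply: ler_sum => i _;
    rewrite mxE [X in _ + X]mxE (le_trans (ler_norm _))//.
  by rewrite normrM ler_wpM2l// coord_le_norm.
have E := diff_unique cl H.
have D : differentiable f x by apply/diff_locallyP; rewrite E.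
split => //; apply/rowP => i; rewrite mxE deriveE// E.
exact: dotv_delta.
Qed.
End convex_calculus.

(** * Integration against a mixture of measures *)

Section integral_mixture.
Local Open Scope ereal_scope.
Import HBNNSimple.
Context d1 d2 (X : measurableType d1) (Y : measurableType d2) (R : realType).
Variables (P : {measure set X -> \bar R}) (k : X -> {measure set Y -> \bar R}).
Variable Q : {measure set Y -> \bar R}.
Hypothesis mk : forall B, measurable B -> measurable_fun setT (fun x => k x B).
Hypothesis QE : forall B, measurable B -> Q B = \int[P]_x k x B.

Let mixture_nnsfun (g : {nnsfun Y >-> R}) :
  \int[Q]_y (g y)%:E = \int[P]_x \int[k x]_y (g y)%:E.
Proof.
under [RHS]eq_integral do rewrite integralT_nnsfun sintegralE.
rewrite ge0_integral_fsum//; last 2 first.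
  by move=> r; apply: measurable_funeM; exact: mk.
  by move=> n x _; exact: nnsfun_mulemu_ge0.
rewrite integralT_nnsfun sintegralE; apply: eq_fsbigr => // r rg.
rewrite QE//; have [r0|r0] := leP 0%R r.
  by rewrite ge0_integralZl_EFin//; exact: mk.
rewrite preimage_nnfun0//.
under eq_integral do rewrite measure0.
rewrite integral0 mule0; under eq_integral do rewrite measure0 mule0.
by rewrite integral0.
Qed.

(** Known on indicators, extended to simple functions by linearity and to
    nonnegative functions by monotone convergence.  It serves for the mixture
    itself and for the disintegration of a coupling. *)
Lemma integral_mixture (f : Y -> \bar R) :
  measurable_fun setT f -> (forall y, 0 <= f y) ->
  \int[Q]_y f y = \int[P]_x \int[k x]_y f y.
Proof.
move=> mf f0.
pose g := nnsfun_approx measurableT mf.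
pose gE := fun n => EFin \o g n.
have mgE n : measurable_fun setT (gE n) by exact/measurable_EFinP.
have gE_ge0 n x : 0 <= gE n x by rewrite lee_fin.
have nd_gE x : {homo gE ^~ x : n m / (n <= m)%O >-> n <= m}.
  by move=> *; exact/lefP/nd_nnsfun_approx.
transitivity (limn (fun n => \int[Q]_x gE n x)).
  rewrite -monotone_convergence//; apply: eq_integral => t _.
  by apply/esym/cvg_lim => //; exact: cvg_nnsfun_approx.
transitivity (limn (fun n => \int[P]_x \int[k x]_y gE n y)).
  by apply: congr_lim; apply/funext => n; exact: mixture_nnsfun.
rewrite -monotone_convergence//; last 3 first.
  by move=> n; exact: measurable_fun_integral_kernel.
  by move=> n x _; exact: integral_ge0.
  by move=> x _ m n mn; apply: ge0_le_integral => // t _; exact: nd_gE.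
apply: eq_integral => x _; rewrite -monotone_convergence//.
by apply: eq_integral => t _; apply/cvg_lim => //; exact: cvg_nnsfun_approx.
Qed.
End integral_mixture.

(** * Functions of exponential growth *)

Section borel.
Context (R : realType) (d : nat).

Lemma continuous_measurable (f : 'rV[R]_d -> R) :
  continuous f -> measurable_fun setT f.
Proof.
move=> /continuousP cf; apply: (measurability _ (RGenOpens.measurableE R)).
move=> _ /= -[_ [a [b ->]] <-].
rewrite setTI; apply: sub_sigma_algebra; apply: cf.
exact: interval_open.
Qed.

(** A class stable under sums and products and integrable against every
    probability with exponential moments, so that all integrals below converge. *)
Definition expgrowth (h : 'rV[R]_d -> R) : Prop :=
  continuous h /\ exists K s, forall x, `|h x| <= K * expR (s * enorm x).

Definition exponential_moments (nu : probability 'rV[R]_d R) : Prop :=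
  forall s : R, 0 < s -> (\int[nu]_x (expR (s * enorm x))%:E < +oo)%E.

Lemma continuous_expnorm s : continuous (fun x : 'rV[R]_d => expR (s * enorm x)).
Proof.
move=> x; apply: (@continuous_comp _ _ _ (fun x => s * enorm x) expR).
  exact: (cvgM (cvg_cst _) (@continuous_enorm _ _ _ id (fun=> cvg_id) x)).
exact: continuous_expR.
Qed.

Lemma expgrowth_integrable (nu : probability 'rV[R]_d R) h :
  exponential_moments nu -> expgrowth h -> nu.-integrable setT (EFin \o h).
Proof.
move=> nue [ch [K [s hK]]].
pose e (x : 'rV[R]_d) := `|K| * expR ((`|s| + 1) * enorm x).
have ce : continuous e.
  by move=> x; exact: (cvgM (cvg_cst _) (@continuous_expnorm (`|s| + 1) x)).
apply: (@le_integrable _ _ _ _ _ measurableT _ (EFin \o e)).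
- by apply/measurable_EFinP; exact: continuous_measurable.
- move=> x _ /=; rewrite lee_fin [leRHS]ger0_norm ?mulr_ge0 ?expR_ge0//.
  apply: le_trans (hK x) _; apply: (@le_trans _ _ (`|K| * expR (s * enorm x))).
    by rewrite ler_wpM2r ?expR_ge0// ler_norm.
  rewrite ler_wpM2l// ler_expR ler_wpM2r ?enorm_ge0//.
  by rewrite (le_trans (ler_norm s))// lerDl.
- have -> : EFin \o e =
      (fun x => `|K|%:E * (expR ((`|s| + 1) * enorm x))%:E)%E by [].
  apply: integrableZl => //; apply/integrableP; split.
    by apply/measurable_EFinP; apply: continuous_measurable;
      exact: continuous_expnorm.
  under eq_integral do rewrite /= ger0_norm ?expR_ge0//.
  by apply: nue; rewrite ltr_wpDl.
Qed.
End borel.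

Section expgrowth_closure.
Context (R : realType) (d : nat).
Implicit Types (f h : 'rV[R]_d -> R) (p : 'rV[R]_d -> 'rV[R]_d) (L : R).

Lemma expgrowth_cst (c : R) : expgrowth (cst c : 'rV[R]_d -> R).
Proof.
split; first exact: cst_continuous.
by exists `|c|, 0 => x; rewrite mul0r expR0 mulr1.
Qed.

Lemma expgrowthM f h : expgrowth f -> expgrowth h ->
  expgrowth (fun x => f x * h x).
Proof.
move=> [cf [K [s fK]]] [ch [K' [s' hK]]]; split.
  by move=> x; exact: (cvgM (cf x) (ch x)).
exists (K * K'), (s + s') => x.
by rewrite normrM mulrDl expRD mulrACA ler_pM.
Qed.

Lemma expgrowthD f h : expgrowth f -> expgrowth h ->
  expgrowth (fun x => f x + h x).
Proof.
move=> [cf [K [s fK]]] [ch [K' [s' hK]]]; split.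
  by move=> x; exact: (cvgD (cf x) (ch x)).
exists (`|K| + `|K'|), (`|s| + `|s'|) => x.
rewrite (le_trans (ler_normD _ _))// mulrDl lerD//.
  apply: le_trans (fK x) _; apply: (@le_trans _ _ (`|K| * expR (s * enorm x))).
    by rewrite ler_wpM2r ?expR_ge0// ler_norm.
  rewrite ler_wpM2l// ler_expR ler_wpM2r ?enorm_ge0//.
  by rewrite (le_trans (ler_norm s))// lerDl.
apply: le_trans (hK x) _; apply: (@le_trans _ _ (`|K'| * expR (s' * enorm x))).
  by rewrite ler_wpM2r ?expR_ge0// ler_norm.
rewrite ler_wpM2l// ler_expR ler_wpM2r ?enorm_ge0//.
by rewrite (le_trans (ler_norm s'))// lerDr.
Qed.

Lemma expgrowthZ (k : R) f : expgrowth f -> expgrowth (fun x => k * f x).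
Proof. by move=> gf; exact: (expgrowthM (expgrowth_cst k) gf). Qed.

(** The test functions of the convex log-Sobolev inequality, with the gradient
    carried along as a continuous subgradient field: in this form the class is
    visibly stable under scaling, translation and log-sum-exp. *)
Definition tame f p L : Prop :=
  [/\ continuous p, subgradient f p, forall x, enorm (p x) <= L &
      bounded_from_below f].

Lemma tame_ge0 f p L : tame f p L -> 0 <= L.
Proof. by case=> _ _ pL _; apply: le_trans (pL 0); exact: enorm_ge0. Qed.

Lemma tame_lipschitz f p L : tame f p L ->
  forall x y, `|f x - f y| <= L * enorm (x - y).
Proof.
move=> [_ fp pL _].
have H x y : f x - f y <= L * enorm (x - y).
  have := fp x y; rewrite -lerBrDl => h.
  rewrite -lerN2 opprB (le_trans _ h)// lerNl -dotvNr opprB.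
  by rewrite (le_trans (dotv_le _ _))// ler_wpM2r ?enorm_ge0.
move=> x y; rewrite ler_norml H andbT lerNl opprB (le_trans (H y x))//.
by rewrite -(enormN (y - x)) opprB.
Qed.

Lemma tame_continuous f p L : tame f p L -> continuous f.
Proof.
move=> [cp fp _ _] x; apply: differentiable_continuous.
by have [] := subgradient_differentiable x fp cp.
Qed.

Lemma tame_le f p L : tame f p L -> forall x, f x <= f 0 + L * enorm x.
Proof.
move=> fpL x; have := tame_lipschitz fpL x 0; rewrite subr0 ler_norml.
by move=> /andP[_]; rewrite lerBlDl.
Qed.

Lemma tame_expgrowth f p L : tame f p L -> expgrowth f.
Proof.
move=> fpL; split; first exact: tame_continuous fpL.
exists (`|f 0| + 1), L => x.
have t0 : 0 <= L * enorm x by rewrite mulr_ge0 ?enorm_ge0// (tame_ge0 fpL).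
have h : `|f x| <= `|f 0| + L * enorm x.
  rewrite -[f x](subrK (f 0)) addrC (le_trans (ler_normD _ _))// lerD2l.
  by have := tame_lipschitz fpL x 0; rewrite subr0.
apply: le_trans h _.
have := ler_wpM2l (_ : 0 <= `|f 0| + 1) (expR_ge1Dx (L * enorm x)).
rewrite addr_ge0// => /(_ isT); apply: le_trans.
have := normr_ge0 (f 0); nra.
Qed.

Lemma tame_expgrowth_expR f p L : tame f p L -> expgrowth (fun x => expR (f x)).
Proof.
move=> fpL; split.
  move=> x; apply: (@continuous_comp _ _ _ f expR); last exact: continuous_expR.
  exact: tame_continuous fpL x.
exists (expR (f 0)), L => x.
by rewrite ger0_norm ?expR_ge0// -expRD ler_expR; exact: tame_le fpL x.
Qed.

Lemma tame_expgrowth_slope f p L : tame f p L ->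
  expgrowth (fun x => enorm (p x) ^+ 2).
Proof.
move=> [cp _ pL _]; split.
  have c := continuous_enorm cp.
  by move=> x; exact: (cvgM (c x) (c x)).
exists (L ^+ 2), 0 => x; rewrite mul0r expR0 mulr1 ger0_norm ?sqr_ge0//.
by rewrite lerXn2r ?nnegrE ?enorm_ge0// (le_trans _ (pL x))// enorm_ge0.
Qed.

Lemma tame_scale k f p L : 0 <= k -> tame f p L ->
  tame (fun x => k * f x) (fun x => k *: p x) (k * L).
Proof.
move=> k0 [cp fp pL [c cf]]; split.
- by move=> x; exact: (cvgZr (cp x)).
- by move=> x y; rewrite dotvZl -mulrDr ler_wpM2l.
- by move=> x; rewrite enormZ ger0_norm// ler_wpM2l.
- by exists (k * c) => x; rewrite ler_wpM2l.
Qed.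

Lemma tame_shift c f p L : tame f p L -> tame (fun x => f x + c) p L.
Proof.
move=> [cp fp pL [b bf]]; split => //.
- by move=> x y; rewrite addrAC lerD2r.
- by exists (b + c) => x; rewrite lerD2r.
Qed.

(** The subgradient inequality at x tested against x + grad f x gives
    |grad f x|^2 <= L |grad f x|. *)
Lemma C1_tame f : convex_function setT f -> C1 f -> euclidean_lipschitz f ->
  bounded_from_below f -> exists L, tame f (gradient f) L.
Proof.
move=> cf [df cg] [L fL] bf; exists `|L|.
have fp := convex_subgradient cf df.
split => // x; have := fp x (x + gradient f x).
rewrite addrAC subrr add0r -enorm_sqr -lerBrDl => h.
have := le_trans h (le_trans (ler_norm _) (fL _ _)).
rewrite addrAC subrr add0r.
have := enorm_ge0 (gradient f x).
rewrite le_eqVlt => /predU1P[<- _//|g0].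
rewrite expr2 ler_pM2r// => /le_trans; apply.
exact: ler_norm.
Qed.

End expgrowth_closure.

(** * The log-Sobolev inequality for test functions *)

Section Rint.
Context (R : realType) (d : nat) (nu : probability 'rV[R]_d R).
Hypothesis nue : exponential_moments nu.
Implicit Types h : 'rV[R]_d -> R.

Lemma EFin_Rint h : expgrowth h ->
  (\int[nu]_x (h x)%:E = (\int[nu]_x h x)%R%:E)%E.
Proof.
move=> hg; rewrite /Rintegral fineK// integrable_fin_num//.
exact: expgrowth_integrable.
Qed.

Lemma Rint_cst (c : R) : \int[nu]_x c = c.
Proof.
by rewrite Rintegral_cst// [X in fine X](@probability_setT _ _ _ nu) mulr1.
Qed.

Lemma Rint_le h1 h2 : expgrowth h1 -> expgrowth h2 ->
  (forall x, h1 x <= h2 x) -> \int[nu]_x h1 x <= \int[nu]_x h2 x.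
Proof.
by move=> g1 g2 h12; apply: le_Rintegral => //; exact: expgrowth_integrable.
Qed.

Lemma Rint_D h1 h2 : expgrowth h1 -> expgrowth h2 ->
  \int[nu]_x (h1 x + h2 x) = \int[nu]_x h1 x + \int[nu]_x h2 x.
Proof.
by move=> g1 g2; apply: RintegralD => //; exact: expgrowth_integrable.
Qed.

Lemma Rint_Z (k : R) h : expgrowth h ->
  \int[nu]_x (k * h x) = k * \int[nu]_x h x.
Proof.
by move=> g; apply: RintegralZl => //; exact: expgrowth_integrable.
Qed.

End Rint.

Definition expint (R : realType) (d : nat) (nu : probability 'rV[R]_d R)
  (f : 'rV[R]_d -> R) : R := \int[nu]_x expR (f x).

Definition energy (R : realType) (d : nat) (nu : probability 'rV[R]_d R)
    (f : 'rV[R]_d -> R) (p : 'rV[R]_d -> 'rV[R]_d) : R :=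
  \int[nu]_x (enorm (p x) ^+ 2 * expR (f x)).

Section LSI.
Context (R : realType) (d : nat) (nu : probability 'rV[R]_d R).

Lemma convex_LSI_le C C' : convex_LSI nu C -> C <= C' -> convex_LSI nu C'.
Proof.
move=> [C0 h] CC'; split => [|f cf f1 fl fb]; first exact: lt_le_trans CC'.
have := h f cf f1 fl fb => /=.
set I := (\int[nu]_x _)%E => hI.
have I0 : (0 <= I)%E.
  by apply: integral_ge0 => x _; rewrite lee_fin mulr_ge0 ?sqr_ge0 ?expR_ge0.
have le : ((C / 2)%:E * I <= (C' / 2)%:E * I)%E.
  by rewrite lee_wpmul2r// lee_fin ler_wpM2r// invr_ge0.
move=> /(le_lt_trans le)/hI[dfn h']; split => //; exact: le_trans h' le.
Qed.

Hypothesis nue : exponential_moments nu.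

Lemma expint_gt0 f p L : tame f p L -> 0 < expint nu f.
Proof.
move=> fpL; have [_ _ _ [c cf]] := fpL; apply: (@lt_le_trans _ _ (expR c)).
  exact: expR_gt0.
rewrite -[leLHS](Rint_cst nu); apply: Rint_le => //.
- exact: expgrowth_cst.
- exact: tame_expgrowth_expR fpL.
- by move=> x; rewrite ler_expR.
Qed.

Lemma energy_ge0 f p : 0 <= energy nu f p.
Proof.
by apply: Rintegral_ge0 => x _; rewrite mulr_ge0 ?sqr_ge0 ?expR_ge0.
Qed.

Lemma LSI_tame C f p L : convex_LSI nu C -> tame f p L ->
  \int[nu]_x (f x * expR (f x)) - expint nu f * ln (expint nu f) <=
  C / 2 * energy nu f p.
Proof.
move=> [C0 lsi] fpL.
have ge := tame_expgrowth_expR fpL.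
have gfe := expgrowthM (tame_expgrowth fpL) ge.
have gpe := expgrowthM (tame_expgrowth_slope fpL) ge.
have [cp fp _ fb] := fpL.
have ef : gradient f = p.
  by apply/funext => x; have [] := subgradient_differentiable x fp cp.
have f1 : C1 f.
  split=> [x|]; last by rewrite ef.
  by have [] := subgradient_differentiable x fp cp.
have fl : euclidean_lipschitz f by exists L; exact: tame_lipschitz fpL.
have := lsi f (subgradient_convex fp) f1 fl fb => /=.
rewrite ef (EFin_Rint nue gpe) -EFinM => /(_ (ltry _))[_].
rewrite /ent.
under eq_integral do rewrite /= expRK mulrC.
rewrite (EFin_Rint nue gfe) (EFin_Rint nue ge).
rewrite lne_EFin; last exact: expint_gt0 fpL.
by rewrite -EFinM -EFinB lee_fin.
Qed.

(** As e^(f/2) = e^f e^(- f/2), Jensen's inequality for the probability with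
    density proportional to e^f bounds the integral of e^(f/2) from below in terms
    of the entropy of e^f, which the log-Sobolev inequality controls. *)
Lemma ln_expint_half C f p L : convex_LSI nu C -> tame f p L ->
  ln (expint nu f) <= 2 * ln (expint nu (fun x => 2^-1 * f x)) +
    C / 2 * (energy nu f p / expint nu f).
Proof.
move=> lsi fpL; have := LSI_tame lsi fpL.
have h0 : (0 : R) <= 2^-1 by rewrite invr_ge0.
have Z0 := expint_gt0 fpL; have H0 := expint_gt0 (tame_scale h0 fpL).
set Z := expint nu f in Z0 *; set H := expint nu _ in H0 *.
set E := \int[nu]_x _; set I := energy _ _ _ => lsiE.
(* m is the mean of f / 2 under the probability proportional to e^f *)
pose m := E / (2 * Z).
have : expR (- m) * ((1 + m) * Z - 2^-1 * E) <= H.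
  have ge := tame_expgrowth_expR fpL.
  have gfe := expgrowthM (tame_expgrowth fpL) ge.
  have g1 := expgrowthZ (1 + m) ge; have g2 := expgrowthZ (- 2^-1) gfe.
  have g3 := expgrowthZ (expR (- m)) (expgrowthD g1 g2).
  have -> : expR (- m) * ((1 + m) * Z - 2^-1 * E) = \int[nu]_x
      (expR (- m) * ((1 + m) * expR (f x) + - 2^-1 * (f x * expR (f x)))).
    by rewrite Rint_Z ?Rint_D ?Rint_Z ?mulNr//; exact: expgrowthD.
  apply: Rint_le => //; first exact: tame_expgrowth_expR (tame_scale h0 fpL).
  move=> x; have -> : 2^-1 * f x = f x + (- m + (m - 2^-1 * f x)) by lra.
  rewrite !expRD [leRHS]mulrCA.
  have -> : (1 + m) * expR (f x) + - 2^-1 * (f x * expR (f x)) =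
    expR (f x) * (1 + (m - 2^-1 * f x)) by ring.
  by rewrite ler_wpM2l ?expR_ge0// ler_wpM2l ?expR_ge0// -expRD expR_ge1Dx.
have -> : (1 + m) * Z - 2^-1 * E = Z by rewrite /m; field; rewrite gt_eqF.
move=> mZH.
have : ln Z - m <= ln H.
  rewrite -[m]expRK -ln_div ?posrE ?expR_gt0// ler_ln ?posrE ?divr_gt0 ?expR_gt0//.
  by rewrite -expRN mulrC.
have : m <= C / 4 * (I / Z) + 2^-1 * ln Z.
  rewrite /m ler_pdivrMr ?mulr_gt0//.
  have -> : (C / 4 * (I / Z) + 2^-1 * ln Z) * (2 * Z) = C / 2 * I + Z * ln Z.
    by field; rewrite gt_eqF.
  by rewrite -lerBlDr.
lra.
Qed.
End LSI.

(** * Weak transport of convex functions *)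

Section transport.
Context (R : realType) (d : nat) (mu1 mu2 : probability 'rV[R]_d R).
Hypotheses (e1 : exponential_moments mu1) (e2 : exponential_moments mu2).

(** The affine minorant of phi at x is integrable once nu has a first moment,
    and its integral is its value at the barycenter. *)
Lemma subgradient_barycenter (nu : {measure set 'rV[R]_d -> \bar R})
    (phi : 'rV[R]_d -> R) (s x : 'rV[R]_d) :
  nu setT = 1%E -> continuous phi -> (forall y, 0 <= phi y) ->
  (forall y, phi x + dotv s (y - x) <= phi y) ->
  (\int[nu]_y (enorm y)%:E < +oo)%E ->
  ((phi x + dotv s (barycenter nu - x))%:E <= \int[nu]_y (phi y)%:E)%E.
Proof.
move=> nu1 cphi phi0 sub nuoo.
have cenorm := @continuous_enorm R d _ id (fun=> cvg_id).
have ie : nu.-integrable setT (EFin \o @enorm R d).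
  apply/integrableP; split.
    by apply/measurable_EFinP; exact: continuous_measurable.
  by under eq_integral do rewrite /= ger0_norm ?enorm_ge0//.
have ic (i : 'I_d) : nu.-integrable setT (EFin \o (fun y : 'rV[R]_d => y 0 i)).
  apply: (le_integrable _ _ _ ie) => //.
    apply/measurable_EFinP; apply: continuous_measurable. exact: continuous_coord.
  move=> y _ /=; rewrite lee_fin [leRHS]ger0_norm ?enorm_ge0//.
  rewrite -sqrtr_sqr; apply: ler_wsqrtr; rewrite (bigD1 i)//= lerDl.
  by rewrite sumr_ge0// => j _; rewrite sqr_ge0.
have icst (c : R) : nu.-integrable setT (EFin \o (fun=> c)).
  apply/integrableP; split; first exact/measurable_EFinP.
  under eq_integral do rewrite /=.
  by rewrite integral_cst// nu1 mule1 ltry.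
have idot (u : 'rV[R]_d) : nu.-integrable setT (EFin \o dotv u) /\
    (\int[nu]_y (dotv u y)%:E = (dotv u (barycenter nu))%:E)%E.
  have iu i : nu.-integrable setT (fun y => (u 0 i)%:E * (y 0 i)%:E)%E.
    by apply: (integrableZl measurableT (u 0 i) (ic i)).
  have e y : (dotv u y)%:E = (\sum_(i < d) (u 0 i)%:E * (y 0 i)%:E)%E.
    by rewrite -sumEFin; apply: eq_bigr => i _; rewrite EFinM.
  rewrite (_ : EFin \o dotv u = fun y => (dotv u y)%:E)//.
  under eq_fun do rewrite e; split; first exact: integrable_sum.
  rewrite integral_sum// e; apply: eq_bigr => i _.
  have bE : barycenter nu 0 i = \int[nu]_y (y 0 i) by rewrite /barycenter mxE.
  rewrite (integralZl measurableT (ic i)) bE.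
  by rewrite /Rintegral fineK//; exact: (integrable_fin_num measurableT (ic i)).
have [idots idotE] := idot s.
have ea y : (phi x + dotv s (y - x))%:E =
    ((phi x - dotv s x)%:E + (dotv s y)%:E)%E.
  by rewrite -EFinD dotvBr; congr (_%:E); ring.
have ia : nu.-integrable setT (EFin \o (fun y => phi x + dotv s (y - x))).
  rewrite (_ : EFin \o _ = fun y => ((phi x - dotv s x)%:E + (dotv s y)%:E)%E).
    exact: (integrableD measurableT (icst _) idots).
  by apply/funext => y /=; rewrite ea.
have -> : (phi x + dotv s (barycenter nu - x))%:E =
    (\int[nu]_y (phi x + dotv s (y - x))%:E)%E.
  under eq_integral do rewrite ea.
  rewrite (integralD measurableT (icst _) idots) integral_cst// nu1 mule1.
  by rewrite idotE ea.
have mphi : measurable_fun setT (EFin \o phi).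
  by apply/measurable_EFinP; exact: continuous_measurable.
have [->|oo] := eqVneq (\int[nu]_y (phi y)%:E)%E +oo%E; first by rewrite leey.
apply: le_integral => //; last by move=> y _; rewrite lee_fin.
apply/integrableP; split => //.
by under eq_integral do rewrite /= ger0_norm//; rewrite ltey.
Qed.

(** With p_x the disintegration of a coupling and b_x its barycenter,
    phi x <= int phi dp_x + s x . (x - b_x) by the previous lemma; Young's
    inequality splits the product into |s x|^2 and the cost |x - b_x|^2 / 2.  All
    terms are nonnegative, so they can be integrated in the extended reals. *)
Lemma transport_subgradient D phi s t :
  (weak_transport_cost mu2 mu1 < D%:E)%E ->
  expgrowth phi -> (forall x, 0 <= phi x) -> subgradient phi s ->
  continuous s -> expgrowth (fun x => enorm (s x) ^+ 2) -> 0 < t ->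
  \int[mu1]_x phi x <=
  \int[mu2]_x phi x + t / 2 * \int[mu1]_x (enorm (s x) ^+ 2) + D / t.
Proof.
move=> /ereal_inf_lt[_ [pi [p [cpl dis ->]]] costD] gphi phi0 sub cs gs t0.
have cphi : continuous phi by case: gphi.
have mphi : measurable_fun setT (fun x => (phi x)%:E).
  by apply/measurable_EFinP; apply: continuous_measurable; case: gphi.
have mix (f : 'rV[R]_d -> R) : continuous f -> (forall y, 0 <= f y) ->
    (\int[mu2]_y (f y)%:E = \int[mu1]_x \int[p x]_y (f y)%:E)%E.
  move=> cf f0; apply: integral_mixture => //.
  - by move=> B mB; exact: measurable_kernel.
  - move=> B mB; have [_ h2] := cpl _ mB.
    exact: etrans (esym h2) (dis setT B measurableT mB).
  - by apply/measurable_EFinP; exact: continuous_measurable.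
have cenorm := @continuous_enorm R d _ id (fun=> cvg_id).
(* mu2 has a first moment, hence so has p_x for almost every x *)
have foo : {ae mu1, forall x, (\int[p x]_y (enorm y)%:E < +oo)%E}.
  have : mu1.-integrable setT (fun x => \int[p x]_y (enorm y)%:E)%E.
    apply/integrableP; split.
      apply: measurable_fun_integral_kernel => //.
      - by move=> U mU; exact: measurable_kernel.
      - by move=> y; rewrite lee_fin enorm_ge0.
      - by apply/measurable_EFinP; exact: continuous_measurable.
    under eq_integral.
      move=> x _; rewrite gee0_abs; last first.
        by apply: integral_ge0 => y _; rewrite lee_fin enorm_ge0.
      over.
    rewrite -mix ?enorm_ge0//; last exact: enorm_ge0.
    apply: le_lt_trans (e2 ltr01); apply: ge0_le_integral => //.
    - by move=> y _; rewrite lee_fin enorm_ge0.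
    - by apply/measurable_EFinP; exact: continuous_measurable.
    - apply/measurable_EFinP; apply: continuous_measurable.
      exact: continuous_expnorm.
    - move=> y _; rewrite lee_fin mul1r (le_trans _ (expR_ge1Dx _))//.
      by rewrite lerDr.
  move=> /(integrable_ae measurableT); apply: filterS => x /(_ I) fx.
  by rewrite ltey_eq fx.
have mbc (i : 'I_d) : measurable_fun setT (fun x => barycenter (p x) 0 i).
  have mc : measurable_fun setT (EFin \o (fun y : 'rV[R]_d => y 0 i)).
    apply/measurable_EFinP; apply: continuous_measurable.
    exact: continuous_coord.
  pose co (y : 'rV[R]_d) := (y 0 i)%:E.
  rewrite (_ : (fun x => _) = fun x =>
    fine (\int[p x]_y co^\+ y - \int[p x]_y co^\- y)%E); last first.
    by apply/funext => x; rewrite /barycenter mxE /Rintegral integralE.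
  apply: measurableT_comp => //; apply: emeasurable_funB.
  - apply: measurable_fun_integral_kernel => //.
    + by move=> U mU; exact: measurable_kernel.
    + exact: measurable_funepos.
  - apply: measurable_fun_integral_kernel => //.
    + by move=> U mU; exact: measurable_kernel.
    + exact: measurable_funeneg.
have mb : measurable_fun setT
    (fun x : 'rV[R]_d => (2^-1 * enorm (x - barycenter (p x)) ^+ 2)%R%:E).
  apply/measurable_EFinP; apply: measurable_funM => //.
  rewrite (_ : (fun x => _) = fun x : 'rV[R]_d =>
      \sum_(i < d) (x 0 i - barycenter (p x) 0 i) ^+ 2); last first.
    apply/funext => x; rewrite enorm_sqr; apply: eq_bigr => i _.
    by rewrite !mxE expr2.
  apply: measurable_sum => i; apply: measurable_funX; apply: measurable_funB => //.
  by apply: continuous_measurable; exact: continuous_coord.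
have key : {ae mu1, forall x, setT x -> ((phi x)%:E <= \int[p x]_y (phi y)%:E +
    ((t / 2)%:E * (enorm (s x) ^+ 2)%:E +
     t^-1%:E * (2^-1 * enorm (x - barycenter (p x)) ^+ 2)%R%:E))%E}.
  apply: filterS foo => x px _.
  have := subgradient_barycenter (prob_kernel x) cphi phi0 (sub x) px.
  set b := barycenter _ => h.
  have -> : phi x = phi x + dotv (s x) (b - x) + dotv (s x) (x - b).
    by rewrite !dotvBr; ring.
  by rewrite EFinD leeD// -!EFinM -EFinD lee_fin dotv_young.
have ms : measurable_fun setT (fun x => (enorm (s x) ^+ 2)%:E).
  by apply/measurable_EFinP; apply: continuous_measurable; case: gs.
have mp : measurable_fun setT (fun x => \int[p x]_y (phi y)%:E)%E.
  apply: measurable_fun_integral_kernel => //.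
  by move=> U mU; exact: measurable_kernel.
have p0 x : (0 <= \int[p x]_y (phi y)%:E)%E.
  by apply: integral_ge0 => y _; rewrite lee_fin.
have s0 x : (0 <= (t / 2)%:E * (enorm (s x) ^+ 2)%:E)%E.
  by rewrite mule_ge0// lee_fin ?sqr_ge0// divr_ge0// ltW.
have b0 x : (0 <= t^-1%:E * (2^-1 * enorm (x - barycenter (p x)) ^+ 2)%R%:E)%E.
  apply: mule_ge0; first by rewrite lee_fin invr_ge0 ltW.
  by rewrite lee_fin mulr_ge0 ?sqr_ge0.
rewrite -lee_fin !EFinD EFinM -!EFin_Rint//.
apply: (@le_trans _ _ _ _ _ (ae_ge0_le_integral measurableT _ mphi _ _ key)).
- by move=> x _; rewrite lee_fin.
- by move=> x _; apply: adde_ge0 => //; exact: adde_ge0.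
- by apply: emeasurable_funD => //; apply: emeasurable_funD;
    apply: measurable_funeM.
have m1 := measurable_funeM (t / 2)%:E ms.
have m2 := measurable_funeM t^-1%:E mb.
rewrite (ge0_integralD mu1 measurableT (fun x _ => p0 x) mp); last 2 first.
- by move=> x _; exact: adde_ge0.
- exact: emeasurable_funD.
rewrite -mix// -addeA leeD2l//.
rewrite (ge0_integralD mu1 measurableT (fun x _ => s0 x) m1)//.
rewrite (ge0_integralZl_EFin mu1 measurableT _ ms); last 2 first.
- by move=> x _; rewrite lee_fin sqr_ge0.
- by rewrite divr_ge0// ltW.
rewrite leeD2l// (ge0_integralZl_EFin mu1 measurableT _ mb); last 2 first.
- by move=> x _; rewrite lee_fin mulr_ge0 ?sqr_ge0.
- by rewrite invr_ge0 ltW.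
rewrite mulrC EFinM; apply: lee_wpmul2l; last exact: ltW.
by rewrite lee_fin invr_ge0 ltW.
Qed.
End transport.

(** * The Herbst argument *)

Section herbst.
Context (R : realType) (d : nat) (nu : probability 'rV[R]_d R).
Hypothesis nue : exponential_moments nu.
Implicit Types (g : 'rV[R]_d -> R) (p : 'rV[R]_d -> 'rV[R]_d).

Lemma energy_le g p M : tame g p M -> energy nu g p <= M ^+ 2 * expint nu g.
Proof.
move=> gpM; have ge := tame_expgrowth_expR gpM; have [_ _ pM _] := gpM.
rewrite -Rint_Z//; apply: Rint_le => //.
- exact: (expgrowthM (tame_expgrowth_slope gpM)).
- exact: expgrowthZ.
- move=> x; rewrite ler_wpM2r ?expR_ge0//.
  by rewrite lerXn2r ?nnegrE ?enorm_ge0// (tame_ge0 gpM).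
Qed.

Lemma expint_shift g p M c : tame g p M ->
  expint nu (fun x => g x + c) = expR c * expint nu g.
Proof.
move=> gpM; rewrite -Rint_Z//; last exact: tame_expgrowth_expR gpM.
by apply: eq_Rintegral => x _; rewrite expRD mulrC.
Qed.

(** The slope of g / 2^k is at most M / 2^k, so the halving that leads from 2^k
    to 2^(k+1) costs 2^k (C / 2) (M / 2^k)^2 = C M^2 / 2^(k+1). *)
Lemma ln_expint_dyadic C g p M n : convex_LSI nu C -> tame g p M ->
  ln (expint nu g) <= 2 ^+ n * ln (expint nu (fun x => 2^-1 ^+ n * g x)) +
    C * M ^+ 2 * (1 - 2^-1 ^+ n).
Proof.
move=> lsi gpM; have C0 : 0 <= C by case: lsi => /ltW.
elim: n => [|n /le_trans]; first by rewrite !expr0 mul1r subrr mulr0 addr0;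
  under eq_fun do rewrite mul1r.
apply; have k0 : (0 : R) <= 2^-1 ^+ n by rewrite exprn_ge0 ?invr_ge0.
have kg := tame_scale k0 gpM; have := ln_expint_half nue lsi kg.
rewrite (_ : (fun x => 2^-1 * (2^-1 ^+ n * g x)) = fun x => 2^-1 ^+ n.+1 * g x).
  set P := ln _; set Q := ln _; set I := _ / expint _ _ => PQ.
  have IM : I <= (2^-1 ^+ n * M) ^+ 2.
    have ex0 := expint_gt0 nue kg.
    rewrite ler_pdivrMr; last by exact: ex0.
    exact: energy_le.
  have : 2 ^+ n * P <= 2 ^+ n * (2 * Q + C / 2 * (2^-1 ^+ n * M) ^+ 2).
    rewrite ler_wpM2l ?exprn_ge0// (le_trans PQ)// lerD2l ler_wpM2l//.
    exact: divr_ge0.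
  rewrite (exprS 2) (exprS 2^-1); set e : R := 2 ^+ n; set k : R := 2^-1 ^+ n.
  have ek : e * k = 1 by rewrite -exprMn divff ?expr1n.
  have -> : e * (2 * Q + C / 2 * (k * M) ^+ 2) =
      2 * e * Q + (e * k) * (C / 2 * k * M ^+ 2) by ring.
  by rewrite ek; lra.
by apply/funext => x; rewrite mulrA exprS.
Qed.

Lemma expR_le_sqr (x : R) : 0 <= x -> expR x <= 1 + x + x ^+ 2 * expR x.
Proof.
move=> x0; have h : expR x <= 1 + x * expR x.
  have := ler_wpM2r (expR_ge0 x) (expR_ge1Dx (- x)).
  by rewrite expRN mulVf ?gt_eqF ?expR_gt0//; lra.
have := ler_wpM2l x0 h; rewrite expr2; lra.
Qed.

(** As n tends to infinity, 2^n ln (int e^(g / 2^n)) tends to int g: for g >= 0 the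
    error is at most 2^-n int g^2 e^g. *)
Lemma herbst C g p M : convex_LSI nu C -> tame g p M ->
  ln (expint nu g) <= \int[nu]_x g x + C * M ^+ 2.
Proof.
move=> lsi gpM; have [_ _ _ [c cg]] := gpM.
wlog g0 : g gpM c cg / forall x, 0 <= g x.
  move=> wl; have := wl _ (tame_shift (- c) gpM) 0.
  rewrite (expint_shift _ gpM) lnM ?posrE ?expR_gt0 ?(expint_gt0 nue gpM)// expRK.
  rewrite (_ : \int[nu]_x (g x - c) = \int[nu]_x g x - c).
    have h x : 0 <= g x - c by rewrite subr_ge0.
    by move=> /(_ h h); lra.
  rewrite Rint_D ?Rint_cst//; first exact: tame_expgrowth gpM.
  exact: expgrowth_cst.
have C0 : 0 <= C by case: lsi => /ltW.
have gg := tame_expgrowth gpM; have ge := tame_expgrowth_expR gpM.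
have gK := expgrowthM (expgrowthM gg gg) ge.
set K := \int[nu]_x (g x * g x * expR (g x)).
have K0 : 0 <= K.
  by apply: Rintegral_ge0 => x _; rewrite mulr_ge0 ?expR_ge0 ?mulr_ge0.
have small n : ln (expint nu g) <=
    \int[nu]_x g x + 2^-1 ^+ n * K + C * M ^+ 2.
  apply: le_trans (ln_expint_dyadic n lsi gpM) _.
  set k : R := 2^-1 ^+ n; set e : R := 2 ^+ n.
  have ek : e * k = 1 by rewrite -exprMn divff ?expr1n.
  have e0 : 0 <= e by rewrite exprn_ge0.
  have k0 : 0 <= k by rewrite exprn_ge0 ?invr_ge0.
  have k1 : k <= 1 by rewrite exprn_ile1 ?invr_ge0// invf_le1// ler1n.
  have kg := tame_scale k0 gpM.
  have : ln (expint nu (fun x => k * g x)) <= k * \int[nu]_x g x + k ^+ 2 * K.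
    have g1 := expgrowthZ k gg; have g2 := expgrowthZ (k ^+ 2) gK.
    have lt : -1 < expint nu (fun x => k * g x) - 1.
      by have := expint_gt0 nue kg; lra.
    have := le_ln1Dx lt; rewrite subrKC => /le_trans; apply.
    rewrite lerBlDl -!Rint_Z// -Rint_D// -[X in X + _](Rint_cst nu) -Rint_D//.
    - apply: Rint_le => //; first exact: tame_expgrowth_expR kg.
        by apply: expgrowthD; [exact: expgrowth_cst|exact: expgrowthD].
      move=> x; have := expR_le_sqr (mulr_ge0 k0 (g0 x)).
      move=> /le_trans; apply; rewrite addrA lerD2l.
      rewrite exprMn [g x ^+ 2]expr2 -[leLHS]mulrA.
      rewrite ler_wpM2l ?exprn_ge0// ler_wpM2l ?mulr_ge0// ler_expR.
      by rewrite ler_piMl.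
    - exact: expgrowth_cst.
    - exact: expgrowthD.
  move=> /(ler_wpM2l e0); rewrite mulrDr mulrA ek mul1r expr2 !mulrA ek mul1r.
  have : C * M ^+ 2 * (1 - k) <= C * M ^+ 2.
    have := mulr_ge0 (mulr_ge0 C0 (sqr_ge0 M)) k0; lra.
  lra.
rewrite leNgt; apply/negP => lt.
set D := ln (expint nu g) - (\int[nu]_x g x + C * M ^+ 2).
have D0 : 0 < D by rewrite subr_gt0.
have := archi_boundP (divr_ge0 K0 (ltW D0)).
move: (Num.bound _) => n; rewrite ltNge => /negP; apply.
have h : D <= 2^-1 ^+ n * K by have := small n; rewrite /D; lra.
rewrite ler_pdivlMr//; apply: (@le_trans _ _ (2 ^+ n * D)).
  by rewrite ler_wpM2r ?(ltW D0)// -natrX ler_nat ltnW// ltn_expl.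
apply: le_trans (ler_wpM2l (exprn_ge0 n _) h) _ => //.
by rewrite mulrA -exprMn divff ?expr1n ?mul1r.
Qed.

End herbst.

(** * Log-sum-exp of affine functions *)

Section log_sum_exp.
Context (R : realType) (d n : nat).
Variables (c : 'I_n.+1 -> R) (w : 'I_n.+1 -> 'rV[R]_d) (b M : R).
Hypotheses (b0 : 0 < b) (wM : forall i, enorm (w i) <= M).

Let l i x := c i + dotv (w i) x.
Let S x := \sum_i expR (b * l i x).

(** Dividing by the number of pieces keeps the function below their maximum,
    from which it differs by at most ln (n + 1) / b. *)
Definition lse x : R := b^-1 * ln (S x / n.+1%:R).

Definition lse_slope x : 'rV[R]_d := (S x)^-1 *: \sum_i expR (b * l i x) *: w i.

Lemma lse_sum_gt0 x : 0 < S x.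
Proof.
by rewrite /S big_ord_recl ltr_wpDr ?expR_gt0 ?sumr_ge0// => i _; exact: expR_ge0.
Qed.

Let M0 : 0 <= M. Proof. by apply: le_trans (wM ord0); exact: enorm_ge0. Qed.

(** The slope is a convex combination of the slopes of the affine pieces. *)
Lemma lse_slope_le x : enorm (lse_slope x) <= M.
Proof.
have S0 := lse_sum_gt0 x; set q := lse_slope x.
have : enorm q ^+ 2 <= M * enorm q.
  rewrite enorm_sqr {1}/q dotvZl ler_pdivrMl// dotv_suml mulr_suml.
  apply: ler_sum => i _; rewrite dotvZl ler_wpM2l ?expR_ge0//.
  by rewrite (le_trans (dotv_le _ _))// ler_wpM2r ?enorm_ge0.
have := enorm_ge0 q; rewrite le_eqVlt => /predU1P[<- _//|q0].
by rewrite expr2 ler_pM2r.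
Qed.

(** The ratio S y / S x is the average, with the weights of the slope at x, of the
    exponentials of b (l i y - l i x); Jensen's inequality bounds it from below by
    the exponential of the averaged exponent b m. *)
Lemma lse_subgradient : subgradient lse lse_slope.
Proof.
move=> x y; have S0 := lse_sum_gt0 x; have S1 := lse_sum_gt0 y.
set m := dotv _ _.
have : expR (b * m) * S x <= S y.
  have -> : expR (b * m) * S x =
      \sum_i expR (b * l i x) * (expR (b * m) *
        (1 + b * dotv (w i) (y - x) - b * m)).
    have e : \sum_i expR (b * l i x) * dotv (w i) (y - x) = S x * m.
      rewrite /m /lse_slope dotvZl mulVKf ?gt_eqF// dotv_suml.
      by apply: eq_bigr => i _; rewrite dotvZl.
    transitivity (expR (b * m) * (\sum_i expR (b * l i x)
      + b * \sum_i expR (b * l i x) * dotv (w i) (y - x)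
      - b * m * \sum_i expR (b * l i x))).
      by rewrite e /S; ring.
    rewrite !mulr_sumr -sumrN -!big_split mulr_sumr; apply: eq_bigr => i _ /=.
    ring.
  apply: ler_sum => i _.
  have -> : b * l i y = b * l i x + (b * m + (b * dotv (w i) (y - x) - b * m)).
    by rewrite /l dotvBr; ring.
  rewrite !expRD ler_wpM2l ?expR_ge0// ler_wpM2l ?expR_ge0//.
  by rewrite -expRD -addrA expR_ge1Dx.
move=> h; rewrite /lse -(ler_pM2l b0) mulrDr !mulVKf ?gt_eqF//.
rewrite !ln_div ?posrE// addrAC lerD2r -[b * m]expRK -lnM ?posrE ?expR_gt0//.
by rewrite ler_ln ?posrE ?mulr_gt0 ?expR_gt0// mulrC.
Qed.

Lemma continuous_lse_slope : continuous lse_slope.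
Proof.
have ce i : continuous (fun x => expR (b * l i x)).
  move=> x; apply: (@continuous_comp _ _ _ (fun x => b * l i x) expR); last first.
    exact: continuous_expR.
  have cd := @continuous_dotv R d _ (cst (w i)) id (@cst_continuous _ _ _)
    (fun=> cvg_id).
  exact: (cvgM (cvg_cst _) (cvgD (cvg_cst _) (cd x))).
have cS : continuous S.
  by apply: continuous_big => [|i _]; [exact: add_continuous|exact: ce].
apply: continuous_row => j.
rewrite (_ : (fun t => _) = fun x => (S x)^-1 * \sum_i expR (b * l i x) * w i 0 j).
  have cs : continuous (fun x => \sum_i expR (b * l i x) * w i 0 j).
    apply: continuous_big => [|i _ x]; first exact: add_continuous.
    exact: (cvgM (ce i x) (cvg_cst _)).
  move=> x; apply: cvgM (cs x); apply: cvgV (cS x).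
  by rewrite gt_eqF// lse_sum_gt0.
apply/funext => x; rewrite /lse_slope mxE summxE; congr (_ * _).
by apply: eq_bigr => i _; rewrite mxE.
Qed.

Lemma lse_ge i x : l i x - ln n.+1%:R / b <= lse x.
Proof.
have S0 := lse_sum_gt0 x.
rewrite /lse -(ler_pM2l b0) mulVKf ?gt_eqF// mulrBr mulrCA divff ?gt_eqF// mulr1.
rewrite ln_div ?posrE ?ltr0n// lerD2r -[leLHS]expRK ler_ln ?posrE ?expR_gt0//.
rewrite /S (bigD1 i)//= lerDl; apply: sumr_ge0 => j _.
exact: expR_ge0.
Qed.

Lemma lse_le x y : (forall i, l i x <= y) -> lse x <= y.
Proof.
move=> ly; have S0 := lse_sum_gt0 x.
rewrite /lse -(ler_pM2l b0) mulVKf ?gt_eqF// -[leRHS]expRK.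
rewrite ler_ln ?posrE ?expR_gt0 ?divr_gt0// ler_pdivrMr//.
rewrite -[n.+1 in leRHS]card_ord mulr_natr -sumr_const.
by apply: ler_sum => i _; rewrite ler_expR ler_wpM2l// ltW.
Qed.

Lemma lse_tame (i : 'I_n.+1) : w i = 0 -> tame lse lse_slope M.
Proof.
move=> wi; split.
- exact: continuous_lse_slope.
- exact: lse_subgradient.
- exact: lse_slope_le.
- exists (c i - ln n.+1%:R / b) => x; apply: le_trans (lse_ge i x).
  by rewrite /l wi -(scale0r 0) dotvZl mul0r addr0.
Qed.
End log_sum_exp.

(** * Minorants of bounded slope *)

Section minorants.
Context (R : realType) (d : nat).
Implicit Types (x : 'rV[R]_d).

Lemma rat_points_dense (x : 'rV[R]_d) (U : set 'rV[R]_d) : nbhs x U ->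
  exists r : 'rV[rat]_d, U (map_mx ratr r).
Proof.
move=> [P xP PU].
have h (i : 'I_d) : exists r : rat, P 0 i (ratr r).
  have : (P 0 i)° !=set0 by exists (x 0 i); exact: xP.
  move=> /(@dense_rat R) /(_ (@open_interior _ _)) [y [Py [r _ rE]]].
  by exists r; rewrite rE; exact: interior_subset Py.
have [r rP] := choice h.
exists (\row_i r i); apply: PU => i j.
by rewrite (ord1 i) !mxE; exact: rP.
Qed.

(** The constant sits at index 0, so that each log-sum-exp of an initial segment
    contains it and is bounded from below. *)
Let piece f p (c M : R) (k : nat) : R * 'rV[R]_d :=
  if k isn't k'.+1 then (c, 0) else
  if unpickle k' isn't Some r then (c, 0) else
  let y : 'rV[R]_d := map_mx ratr (r : 'rV[rat]_d) in
  if enorm (p y) < M then (f y - dotv (p y) y, p y) else (c, 0).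

(** At a point x of slope less than M, the tangents at nearby rational points are
    among the pieces and come arbitrarily close to f x.  With n + 1 pieces and
    b = (n + 1)^2 the smoothing error is below 1 / (n + 1). *)
Lemma tangent_minorants f (p : 'rV[R]_d -> 'rV[R]_d) L M :
  tame f p L -> 0 <= M ->
  exists g q, [/\ forall n : nat, tame (g n) (q n) M,
    forall n x, g n x <= f x &
    forall x e, enorm (p x) < M -> 0 < e ->
      \forall n \near \oo, f x - e <= g n x].
Proof.
move=> fpL M0; have [cp fp _ [c cf]] := fpL.
pose P k := piece f p c M k.
have Pf k x : (P k).1 + dotv (P k).2 x <= f x.
  have h0 : c + dotv 0 x <= f x by rewrite -(scale0r 0) dotvZl mul0r addr0.
  rewrite /P /piece; case: k => [//|k]; case: unpickle => [r|//].
  case: ifPn => _ //=; set y := map_mx _ _.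
  by have := fp y x; rewrite dotvBr; lra.
have PM k : enorm (P k).2 <= M.
  rewrite /P /piece; case: k => [|k]; first by rewrite enorm0.
  case: unpickle => [r|]; last by rewrite enorm0.
  by case: ifPn => [/ltW//|_]; rewrite /= enorm0.
pose b n : R := n.+1%:R ^+ 2.
have b0 n : 0 < b n by rewrite exprn_gt0.
exists (fun n => lse (fun i : 'I_n.+1 => (P i).1) (fun i => (P i).2) (b n)).
exists (fun n => lse_slope (fun i : 'I_n.+1 => (P i).1) (fun i => (P i).2) (b n)).
split => [n|n x|x e pxM e0].
- by apply: (@lse_tame _ _ _ _ _ _ _ (b0 n) _ ord0) => // i; exact: PM.
- exact: lse_le.
have e2 : 0 < e / 2 by rewrite divr_gt0.
have [r [rM rf]] : exists r : 'rV[rat]_d, let y : 'rV[R]_d := map_mx ratr r in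
    enorm (p y) < M /\ f x - e / 2 < f y + dotv (p y) (x - y).
  apply: (rat_points_dense (x := x)
    (U := fun y => enorm (p y) < M /\ f x - e / 2 < f y + dotv (p y) (x - y))).
  have cE := continuous_enorm cp.
  have cT : continuous (fun y : 'rV[R]_d => f y + dotv (p y) (x - y)).
    have cxy : continuous (fun y : 'rV[R]_d => x - y).
      by move=> y; exact: (cvgB (cvg_cst _) cvg_id).
    have cd := continuous_dotv cp cxy.
    by move=> y; exact: (continuousD (@tame_continuous _ _ _ _ _ fpL y) (cd y)).
  near=> y; split; near: y; first exact: (cvgr_lt _ (cE x)).
  apply: (cvgr_gt _ (cT x)).
  by rewrite subrr -(scale0r 0) dotvZr mul0r; lra.
pose k := (pickle r).+1.
have Pk : (P k).1 + dotv (P k).2 x = f (map_mx ratr r) +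
    dotv (p (map_mx ratr r)) (x - map_mx ratr r).
  by rewrite /P /piece /k pickleK rM/= dotvBr; lra.
near=> n.
have kn : (k < n.+1)%N by rewrite ltnS; near: n; exact: nbhs_infty_ge.
apply: le_trans (lse_ge (fun i : 'I_n.+1 => (P i).1) (fun i => (P i).2) (b0 n)
  (Ordinal kn) x).
rewrite /= Pk.
suff : ln n.+1%:R / b n <= e / 2 by lra.
apply: (@le_trans _ _ n.+1%:R^-1).
  rewrite ler_pdivrMr// /b expr2 mulKf// ltW// ln_sublinear// ltr0n//.
by apply: ltW; near: n; exact: near_infty_natSinv_lt (PosNum e2).
Unshelve. all: by end_near. Qed.
End minorants.

(** * Comparison of exponential integrals *)

Section compare.
Context (R : realType) (d : nat) (mu1 mu2 : probability 'rV[R]_d R).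
Hypotheses (e1 : exponential_moments mu1) (e2 : exponential_moments mu2).
Variables (C D : R).
Hypothesis lsi : convex_LSI mu1 C.
Hypothesis cost : (weak_transport_cost mu2 mu1 < D%:E)%E.
Implicit Types (f g : 'rV[R]_d -> R) (p q : 'rV[R]_d -> 'rV[R]_d).

Lemma Rint_le_ln_expint f p L : tame f p L ->
  \int[mu2]_x f x <= ln (expint mu2 f).
Proof.
move=> fpL; set m := \int[mu2]_x f x.
rewrite -[m]expRK ler_ln ?posrE ?expR_gt0 ?(expint_gt0 e2 fpL)//.
have gf := tame_expgrowth fpL; have ge := tame_expgrowth_expR fpL.
have gm : expgrowth (fun x => f x + (1 - m)).
  by apply: expgrowthD => //; exact: expgrowth_cst.
have -> : expR m = \int[mu2]_x (expR m * (f x + (1 - m))).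
  rewrite Rint_Z// Rint_D ?Rint_cst//; last exact: expgrowth_cst.
  by rewrite -/m; ring.
apply: Rint_le => //; first exact: expgrowthZ.
move=> x; rewrite -[in leRHS](subrKC m (f x)) expRD ler_wpM2l ?expR_ge0//.
have := expR_ge1Dx (f x - m); lra.
Qed.

Lemma transport_tame g q M t : tame g q M -> 0 < t ->
  \int[mu1]_x g x <= \int[mu2]_x g x + t / 2 * M ^+ 2 + D / t.
Proof.
move=> gqM t0; have [cq gq qM [c cg]] := gqM.
have gs := tame_shift (- c) gqM.
have [_ gsq _ _] := gs.
have h0 x : 0 <= g x - c by rewrite subr_ge0.
have := transport_subgradient e1 e2 cost (tame_expgrowth gs) h0 gsq cq
  (tame_expgrowth_slope gqM) t0.
have gg := tame_expgrowth gqM; have gc := @expgrowth_cst R d (- c).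
rewrite !Rint_D// !Rint_cst => h.
have : \int[mu1]_x enorm (q x) ^+ 2 <= M ^+ 2.
  rewrite -[leRHS](Rint_cst mu1); apply: Rint_le => //.
  - exact: tame_expgrowth_slope gqM.
  - exact: expgrowth_cst.
  - by move=> x; rewrite lerXn2r ?nnegrE ?enorm_ge0// (tame_ge0 gqM).
have t2 : 0 <= t / 2 by rewrite divr_ge0// ltW.
move=> /(ler_wpM2l t2); lra.
Qed.

Variables (f : 'rV[R]_d -> R) (p : 'rV[R]_d -> 'rV[R]_d) (L : R).
Hypothesis fpL : tame f p L.

(** Transport of the convex function e^(f/2), whose squared slope is a quarter of
    the energy density.  The exponential on the left comes from [ln_expint_half]
    on mu1; on mu2 the integral of e^(f/2) is at most the square root of that of
    e^f. *)
Lemma compare_small u s : 0 < s ->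
  energy mu1 f p <= u * expint mu1 f ->
  Num.sqrt (expint mu1 f) * (expR (- (C * u / 4)) - s * u / 8 - D / s) <=
  Num.sqrt (expint mu2 f).
Proof.
move=> s0 eu; have h0 : (0 : R) <= 2^-1 by rewrite invr_ge0.
have hf := tame_scale h0 fpL.
have a0 := expint_gt0 e1 fpL; have b0 := expint_gt0 e2 fpL.
have H10 := expint_gt0 e1 hf; have H20 := expint_gt0 e2 hf.
set h := fun x => 2^-1 * f x in hf H10 H20 *.
have gh := tame_expgrowth_expR hf.
set a := expint mu1 f in eu a0 *; set b := expint mu2 f in b0 *.
have hsq x : expR (h x) ^+ 2 = expR (f x).
  by rewrite -expRM_natl /h mulrA mulfV// mul1r.
(* the variance of e^h under mu2 is nonnegative *)
have H2b : expint mu2 h <= Num.sqrt b.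
  have gh2 := expgrowthM gh gh.
  have gZ := expgrowthZ (- (2 * expint mu2 h)) gh.
  have gc := @expgrowth_cst R d (expint mu2 h ^+ 2).
  have : 0 <= \int[mu2]_x (expR (h x) * expR (h x) +
      - (2 * expint mu2 h) * expR (h x) + expint mu2 h ^+ 2).
    apply: Rintegral_ge0 => x _.
    rewrite (_ : _ + _ = (expR (h x) - expint mu2 h) ^+ 2) ?sqr_ge0//; ring.
  rewrite (Rint_D e2 (expgrowthD gh2 gZ) gc) (Rint_D e2 gh2 gZ) (Rint_Z e2 _ gh).
  rewrite Rint_cst; have -> : \int[mu2]_x (expR (h x) * expR (h x)) = b.
    by apply: eq_Rintegral => x _; rewrite -expr2 hsq.
  rewrite -/(expint mu2 h) => hb.
  rewrite -(ger0_norm (ltW H20)) -sqrtr_sqr ler_wsqrtr//; nra.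
apply: le_trans H2b.
pose sg x := expR (h x) *: (2^-1 *: p x).
have [cp fp _ _] := fpL; have [cph hph _ _] := hf.
have csg : continuous sg.
  have ceh : continuous (fun x => expR (h x)) by case: gh.
  by move=> x; exact: (cvgZ (ceh x) (cph x)).
have sgE x : enorm (sg x) ^+ 2 = 4^-1 * (enorm (p x) ^+ 2 * expR (f x)).
  rewrite !enormZ !exprMn [`|expR _|]ger0_norm ?expR_ge0// hsq.
  by rewrite [`|2^-1|]ger0_norm//; field.
have gE := expgrowthM (tame_expgrowth_slope fpL) (tame_expgrowth_expR fpL).
have gsg : expgrowth (fun x => enorm (sg x) ^+ 2).
  by under eq_fun do rewrite sgE; exact: expgrowthZ.
have sub : subgradient (fun x => expR (h x)) sg.
  move=> x y; rewrite dotvZl -[h y](subrKC (h x)) expRD.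
  rewrite -[X in X + _]mulr1 -mulrDr ler_wpM2l ?expR_ge0//.
  have := hph x y; have := expR_ge1Dx (h y - h x); lra.
have sa0 : 0 < Num.sqrt a by rewrite sqrtr_gt0.
have sa2 : Num.sqrt a ^+ 2 = a by rewrite sqr_sqrtr// ltW.
have := transport_subgradient e1 e2 cost gh (fun x => expR_ge0 _) sub csg gsg
  (divr_gt0 s0 sa0).
rewrite -!/(expint _ _).
have -> : \int[mu1]_x enorm (sg x) ^+ 2 = 4^-1 * energy mu1 f p.
  by rewrite -Rint_Z//; apply: eq_Rintegral => x _; exact: sgE.
have H1 : Num.sqrt a * expR (- (C * u / 4)) <= expint mu1 h.
  rewrite -ler_ln ?posrE ?mulr_gt0 ?expR_gt0// lnM ?posrE ?expR_gt0// expRK.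
  have := ln_expint_half e1 lsi fpL; rewrite -/h -/a.
  have : energy mu1 f p / a <= u by rewrite ler_pdivrMr.
  have C0 : 0 <= C / 2 by case: lsi => /ltW C0 _; rewrite divr_ge0.
  move=> /(ler_wpM2l C0).
  have -> : ln a = 2 * ln (Num.sqrt a)
    by rewrite -sa2 lnXn// mulr_natl sqrtr_sqr ger0_norm// ltW.
  lra.
have -> : D / (s / Num.sqrt a) = Num.sqrt a * (D / s).
  by field; rewrite !gt_eqF.
have : s / Num.sqrt a / 2 * (4^-1 * energy mu1 f p) <= Num.sqrt a * (s * u / 8).
  apply: (@le_trans _ _ (s / Num.sqrt a / 2 * (4^-1 * (u * Num.sqrt a ^+ 2)))).
    by rewrite ler_wpM2l ?divr_ge0 ?(ltW s0) ?(ltW sa0)// ler_wpM2l// sa2.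
  rewrite le_eqVlt; apply/orP; left; apply/eqP; field.
  by rewrite gt_eqF.
lra.
Qed.

(** Where the slope of f is less than M, e^f is the limit of e^(g n) for the
    minorants g n, and the exponential integrals of the g n are bounded uniformly
    by Herbst's argument, transport and Jensen's inequality.  Elsewhere e^f is at
    most M^-2 times the energy density.  Adding that density to e^(g n) everywhere
    makes Fatou's lemma apply on the whole space. *)
Lemma compare_large M t : 0 < M -> 0 < t ->
  expint mu1 f <= expint mu2 f * expR (t / 2 * M ^+ 2 + D / t + C * M ^+ 2) +
    (M ^+ 2)^-1 * energy mu1 f p.
Proof.
move=> M0 t0; set B := _ * expR _.
have [g [q [gq gf gcvg]]] := tangent_minorants fpL (ltW M0).
have b0 := expint_gt0 e2 fpL.
have gB n : expint mu1 (g n) <= B.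
  have a0 := expint_gt0 e1 (gq n).
  rewrite -ler_ln ?posrE ?mulr_gt0 ?expR_gt0// lnM ?posrE ?expR_gt0// expRK.
  apply: le_trans (herbst e1 lsi (gq n)) _; rewrite addrA lerD2r addrA.
  apply: le_trans (transport_tame (gq n) t0) _; rewrite !lerD2r.
  apply: le_trans (Rint_le_ln_expint fpL); apply: Rint_le => //.
  - exact: tame_expgrowth (gq n).
  - exact: tame_expgrowth fpL.
have gE := expgrowthM (tame_expgrowth_slope fpL) (tame_expgrowth_expR fpL).
have M20 : 0 <= (M ^+ 2)^-1 by rewrite invr_ge0 sqr_ge0.
pose F n x := expR (g n x) + (M ^+ 2)^-1 * (enorm (p x) ^+ 2 * expR (f x)).
have gF n : expgrowth (F n).
  apply: expgrowthD; last exact: expgrowthZ.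
  exact: tame_expgrowth_expR (gq n).
have F0 n x : 0 <= F n x.
  by rewrite addr_ge0 ?expR_ge0// mulr_ge0// mulr_ge0 ?sqr_ge0 ?expR_ge0.
have mF n : measurable_fun setT (fun x => (F n x)%:E).
  by apply/measurable_EFinP; apply: continuous_measurable; case: (gF n).
have fa := fatou mu1 measurableT mF (fun n x _ => F0 n x).
have liminf_ge x : ((expR (f x))%:E <= limn_einf (fun n => (F n x)%:E))%E.
  apply/lee_subgt0Pr => e e0; rewrite limn_einf_lim.
  have [N _ NF] : \forall n \near \oo, expR (f x) - e <= F n x.
    have [pM|pM] := ltP (enorm (p x)) M; last first.
      apply: nearW => n; apply: (@le_trans _ _ (expR (f x))).
        by rewrite gerBl ltW.
      apply: ler_wpDl; first exact: expR_ge0.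
      rewrite mulrA ler_peMl ?expR_ge0// ler_pdivlMl ?exprn_gt0// mulr1.
      by rewrite lerXn2r ?nnegrE ?enorm_ge0// ltW.
    have e'0 : 0 < e / expR (f x) by rewrite divr_gt0// expR_gt0.
    apply: filterS (gcvg x _ pM e'0) => n gn.
    apply: ler_wpDr; first by rewrite mulr_ge0// mulr_ge0 ?sqr_ge0 ?expR_ge0.
    rewrite -ler_expR expRD in gn; apply: le_trans gn.
    have := ler_wpM2l (expR_ge0 (f x)) (expR_ge1Dx (- (e / expR (f x)))).
    by rewrite mulrDr mulr1 mulrN mulrCA divff ?mulr1// gt_eqF// expR_gt0.
  apply: lime_ge; first exact: is_cvg_einfs.
  exists N => // n /= Nn; apply: le_ereal_inf_tmp => _ [k /= nk <-].
  by rewrite -EFinB lee_fin; apply: NF; exact: leq_trans nk.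
have up : (limn_einf (fun n => \int[mu1]_x (F n x)%:E) <=
    (B + (M ^+ 2)^-1 * energy mu1 f p)%:E)%E.
  rewrite limn_einf_lim; apply: lime_le; first exact: is_cvg_einfs.
  apply: nearW => n; apply: (@le_trans _ _ (\int[mu1]_x (F n x)%:E)%E).
    by apply: ereal_inf_lbound; exists n => /=.
  rewrite EFin_Rint// lee_fin Rint_D//; last 2 first.
  - exact: tame_expgrowth_expR (gq n).
  - exact: expgrowthZ.
  by rewrite Rint_Z// lerD2r; exact: gB.
rewrite -lee_fin -EFin_Rint//; last exact: tame_expgrowth_expR fpL.
apply: le_trans up; apply: le_trans fa; apply: ge0_le_integral => //.
- apply/measurable_EFinP; apply: continuous_measurable.
  exact: (proj1 (tame_expgrowth_expR fpL)).
- rewrite /limn_einf; apply: measurableT_comp => //.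
  by apply: measurable_fun_limn_esup => n; exact: measurableT_comp.
Qed.
End compare.

(** * The ratio of exponential integrals and its cost *)

Section threshold.
Context (R : realType).
Implicit Types (v c : R).

(** A lower bound for int e^f dmu2 / int e^f dmu1 when v^2 = N u: the first branch
    comes from [compare_small], the second from [compare_large], where
    6/5 >= ln 3 pays for the third of the mass that is kept.  At 7/4 both branches
    still fit under the bound of [entropy_deficit_le]. *)
Definition mass_ratio v : R :=
  if v <= 7 / 4 then (1 - v / 4 - v ^+ 2 / 16) ^+ 2
  else expR (- (6 / 5 + 49 / 80 * v + 3 / 8 * v ^+ 2)).

Lemma ln_le_subr1 (x : R) : 0 < x -> ln x <= x - 1.
Proof.
by move=> x0; have := @le_ln1Dx R (x - 1); rewrite subrKC; apply; lra.
Qed.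

Lemma entropy_deficit_antitone (r c : R) : 0 < r -> r <= c -> c <= 1 ->
  - ln c - 1 + c <= - ln r - 1 + r.
Proof.
move=> r0 rc c1; have c0 : 0 < c := lt_le_trans r0 rc.
have := ln_le_subr1 (divr_gt0 r0 c0); rewrite ln_div ?posrE// => h.
have : r / c - 1 <= r - c.
  rewrite -subr_ge0 (_ : _ - _ = (c - r) * (1 - c) / c); last first.
    by field; rewrite gt_eqF.
  by rewrite divr_ge0 ?(ltW c0)// mulr_ge0; lra.
lra.
Qed.

Lemma small_ratio_gt0 v : 0 <= v -> v <= 7 / 4 -> 0 < 1 - v / 4 - v ^+ 2 / 16.
Proof. by move=> v0 v7; nra. Qed.

(** In terms of y = v / 4, the difference of the two sides is y^2 times a
    polynomial that is positive up to y = 7/16. *)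
Lemma small_ratio_poly v (r := 1 - v / 4 - v ^+ 2 / 16) : 0 <= v -> v <= 7 / 4 ->
  2 * (1 - r) - r + r ^+ 3 <= r * (7 / 8 * v ^+ 2).
Proof.
move=> v0 v7; have y0 : 0 <= v / 4 by lra.
have y7 : v / 4 <= 7 / 16 by lra.
rewrite /r (_ : v ^+ 2 / 16 = (v / 4) ^+ 2); last by field.
rewrite (_ : v ^+ 2 = 16 * (v / 4) ^+ 2); last by field.
move: (v / 4) y0 y7 => y y0 y7; rewrite -subr_ge0.
have -> : (1 - y - y ^+ 2) * (7 / 8 * (16 * y ^+ 2)) -
   (2 * (1 - (1 - y - y ^+ 2)) - (1 - y - y ^+ 2) + (1 - y - y ^+ 2) ^+ 3) =
   y ^+ 2 * (11 - 19 * y - 14 * (y * y) + 3 * y ^+ 3 + y ^+ 4) by field.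
have yy : y * y <= 7 / 16 * y by rewrite ler_wpM2r.
have := exprn_ge0 3 y0; have := exprn_ge0 4 y0 => y4 y3.
rewrite mulr_ge0 ?sqr_ge0//; lra.
Qed.

Lemma mass_ratio_gt0 v : 0 <= v -> 0 < mass_ratio v.
Proof.
move=> v0; rewrite /mass_ratio; case: ifPn => [v7|_]; last exact: expR_gt0.
by rewrite exprn_gt0// small_ratio_gt0.
Qed.

(** If c = t / a, then a (- ln c - 1 + c) is a ln (a / t) - a + t.  The bound 7/8
    leaves N/8 for the entropy of a single component. *)
Lemma entropy_deficit_le v c : 0 <= v -> mass_ratio v <= c -> c <= 1 ->
  - ln c - 1 + c <= 7 / 8 * v ^+ 2.
Proof.
move=> v0 vc c1; have r0 := mass_ratio_gt0 v0.
apply: le_trans (entropy_deficit_antitone r0 vc c1) _.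
rewrite /mass_ratio; case: (leP v (7 / 4)) => [v7|v7].
  set r := 1 - v / 4 - v ^+ 2 / 16.
  have rp : 0 < r by rewrite small_ratio_gt0.
  rewrite lnXn//.
  have : - ln r <= r^-1 - 1.
    by rewrite -lnV ?posrE//; apply: ln_le_subr1; rewrite invr_gt0.
  have : 2 * (r^-1 - 1) - 1 + r ^+ 2 <= 7 / 8 * v ^+ 2.
    rewrite -(ler_pM2r rp).
    rewrite (_ : (_ - 1 + _) * r = 2 * (1 - r) - r + r ^+ 3); last first.
      by field; rewrite gt_eqF.
    by rewrite [leRHS]mulrC; apply: small_ratio_poly.
  by rewrite -mulr_natl; lra.
set U := 6 / 5 + _ + _; rewrite expRK.
have v2 : 7 / 4 * v <= v ^+ 2 by rewrite expr2 ler_wpM2r// ltW.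
have U3 : 342 / 100 <= U by rewrite /U; lra.
have : expR (- U) <= (1 + U)^-1.
  rewrite expRN lef_pV2 ?posrE ?expR_gt0//; last by lra.
  exact: expR_ge1Dx.
have : (1 + U)^-1 <= 100 / 442.
  by rewrite -[leLHS]mul1r ler_pdivrMr; lra.
rewrite /U; lra.
Qed.

End threshold.

Section key.
Context (R : realType) (d : nat) (mu1 : probability 'rV[R]_d R).
Hypotheses (e1 : exponential_moments mu1).
Variables (C D N : R).
Hypotheses (lsi : convex_LSI mu1 C) (CN : C <= N / 4) (DN : D <= N / 8).
Variables (f : 'rV[R]_d -> R) (p : 'rV[R]_d -> 'rV[R]_d) (L : R).
Hypothesis fpL : tame f p L.

Let C0 : 0 < C. Proof. by case: lsi. Qed.
Let N0 : 0 < N. Proof. by move: CN C0; lra. Qed.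

(** The free parameters are chosen near their optimum: s = v / u for small v, and
    M^2 = 3u/2, t = 2N / (5v) for large v. *)
Lemma compare_mass (mu2 : probability 'rV[R]_d R) u :
  exponential_moments mu2 -> (weak_transport_cost mu2 mu1 < D%:E)%E ->
  0 < u -> energy mu1 f p <= u * expint mu1 f ->
  expint mu1 f * mass_ratio (Num.sqrt (N * u)) <= expint mu2 f.
Proof.
move=> e2 cost u0 eu; set v := Num.sqrt _.
have v0 : 0 < v by rewrite sqrtr_gt0 mulr_gt0.
have v2 : v ^+ 2 = N * u by rewrite sqr_sqrtr// mulr_ge0// ltW.
have a0 := expint_gt0 e1 fpL; have b0 := expint_gt0 e2 fpL.
have Cu : C * u <= v ^+ 2 / 4 by rewrite v2; have := ler_wpM2r (ltW u0) CN; lra.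
rewrite /mass_ratio; case: (leP v (7 / 4)) => [v7|v7].
  have := compare_small e1 e2 lsi cost fpL (divr_gt0 v0 u0) eu.
  set r := 1 - v / 4 - v ^+ 2 / 16; set r' := _ - _ => h.
  have rp : 0 < r by rewrite small_ratio_gt0// ltW.
  have rr : r <= r'.
    have h1 : v / u * u / 8 = v / 8 by rewrite divfK// gt_eqF.
    have h2 : D / (v / u) <= v / 8.
      rewrite ler_pdivrMr ?divr_gt0//.
      have -> : v / 8 * (v / u) = N / 8.
        rewrite (_ : _ * _ = v ^+ 2 / (8 * u)); last by field; rewrite gt_eqF.
        by rewrite v2; field; rewrite gt_eqF.
      exact: DN.
    have := expR_ge1Dx (- (C * u / 4)); rewrite /r /r' h1; lra.
  have sa0 : 0 <= Num.sqrt (expint mu1 f) by rewrite sqrtr_ge0.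
  have := le_trans (ler_wpM2l sa0 rr) h.
  rewrite -[X in X <= _]ger0_norm ?mulr_ge0 ?(ltW rp)// => hs.
  rewrite -[leRHS]sqr_sqrtr ?(ltW b0)// -[expint mu1 f]sqr_sqrtr ?(ltW a0)//.
  rewrite -exprMn -[X in X <= _]real_normK ?num_real//.
  by rewrite lerXn2r ?nnegrE ?sqrtr_ge0.
pose M := Num.sqrt (3 / 2 * u); pose t := 2 * N / (5 * v).
have M0 : 0 < M by rewrite sqrtr_gt0 mulr_gt0.
have M2 : M ^+ 2 = 3 / 2 * u by rewrite sqr_sqrtr// mulr_ge0// ltW.
have t0 : 0 < t by rewrite divr_gt0 ?mulr_gt0.
have := compare_large e1 e2 lsi cost fpL M0 t0.
set a := expint mu1 f in eu a0 *; set b := expint mu2 f in b0 *.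
set E := _ + _ + C * _ => ab.
have EU : E <= 49 / 80 * v + 3 / 8 * v ^+ 2.
  have h1 : t / 2 * M ^+ 2 = 3 / 10 * v.
    rewrite M2 /t (_ : _ * _ = 3 / 10 * (N * u) / v); last by field; rewrite gt_eqF.
    by rewrite -v2; field; rewrite gt_eqF.
  have h2 : D / t <= 5 / 16 * v.
    rewrite ler_pdivrMr// /t [leRHS](_ : _ = N / 8)//.
    by field; rewrite gt_eqF.
  by rewrite /E h1 M2; lra.
have ab3 : a / 3 <= b * expR E.
  have : (M ^+ 2)^-1 * energy mu1 f p <= 2 / 3 * a.
    rewrite ler_pdivrMl ?exprn_gt0// M2; lra.
  lra.
have e65 : expR (- (6 / 5)) <= 3^-1 :> R.
  rewrite expRN lef_pV2 ?posrE ?expR_gt0//.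
  have -> : 6 / 5 = 8%:R * (3 / 20) :> R by field.
  rewrite expRM_natl; apply: (@le_trans _ _ ((23 / 20) ^+ 8)); first by lra.
  have m : 23 / 20 <= expR (3 / 20) :> R by have := expR_ge1Dx (3 / 20 : R); lra.
  by apply: lerXn2r m; rewrite nnegrE ?expR_ge0//; lra.
apply: (@le_trans _ _ (a / 3 * expR (- E))).
  rewrite -[leRHS]mulrA ler_wpM2l ?(ltW a0)// -addrA opprD expRD.
  by rewrite ler_pM ?expR_ge0// ler_expR lerN2.
by rewrite expRN ler_pdivrMr// expR_gt0.
Qed.

(** The integral splits into the entropy of e^f, at most C/2 <= N/8 times the
    energy, and the deficit of [entropy_deficit_le].  The energy may vanish while
    the comparison wants u > 0, hence the detour through energy + e / N. *)
Lemma relative_entropy_le (t : R) :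
  0 < t -> t <= expint mu1 f ->
  (forall u, 0 < u -> energy mu1 f p <= u * expint mu1 f ->
     expint mu1 f * mass_ratio (Num.sqrt (N * u)) <= t) ->
  \int[mu1]_x (expR (f x) * (f x - ln t) - expR (f x) + t) <= N * energy mu1 f p.
Proof.
move=> t0 ta mt; set a := expint mu1 f in ta mt *.
have a0 : 0 < a := expint_gt0 e1 fpL.
have ge := tame_expgrowth_expR fpL.
have gfe := expgrowthM (tame_expgrowth fpL) ge.
have -> : \int[mu1]_x (expR (f x) * (f x - ln t) - expR (f x) + t) =
    (\int[mu1]_x (f x * expR (f x)) - a * ln a) +
     a * (- ln (t / a) - 1 + t / a).
  have gl := expgrowthZ (- (ln t + 1)) ge.
  transitivity (\int[mu1]_x (f x * expR (f x) + (- (ln t + 1)) * expR (f x) + t)).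
    by apply: eq_Rintegral => x _; ring.
  rewrite (Rint_D e1 (expgrowthD gfe gl) (@expgrowth_cst R d t)) (Rint_D e1 gfe gl).
  rewrite Rint_cst (Rint_Z e1 _ ge) -/(expint mu1 f) -/a ln_div ?posrE//.
  by field; rewrite gt_eqF.
have ent := LSI_tame e1 lsi fpL.
apply/ler_addgt0Pr => e e_gt0.
set I := energy mu1 f p in mt ent *.
have I0 : 0 <= I := energy_ge0 mu1 f p.
pose u := (I + e / N) / a.
have u0 : 0 < u by rewrite divr_gt0// ltr_wpDl// divr_gt0.
have ua : u * a = I + e / N by rewrite /u divfK// gt_eqF.
have Iu : I <= u * a by rewrite ua lerDl divr_ge0// ltW.
have := @entropy_deficit_le R (Num.sqrt (N * u)) (t / a) (sqrtr_ge0 _).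
rewrite ler_pdivlMr// mulrC => /(_ (mt _ u0 Iu)).
rewrite ler_pdivrMr// mul1r => /(_ ta).
have Nu0 : 0 <= N * u := mulr_ge0 (ltW N0) (ltW u0).
rewrite sqr_sqrtr// => /(ler_wpM2l (ltW a0)).
have -> : a * (7 / 8 * (N * u)) = 7 / 8 * (N * I + e).
  rewrite [LHS](_ : _ = 7 / 8 * N * (u * a)); last by ring.
  by rewrite ua; field; rewrite gt_eqF.
have : C / 2 * I <= N / 8 * I by rewrite ler_wpM2r//; move: CN; lra.
have := mulr_ge0 (ltW N0) I0; move: ent; rewrite -/a; lra.
Qed.
End key.

(** * Entropy of a mixture *)

Section relative_entropy.
Context (R : realType).

(** The function s ln (s / t) - s + t of s = e^y. *)
Definition rel_density (t y : R) : R := expR y * (y - ln t) - expR y + t.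

Lemma rel_density_ge0 (t y : R) : 0 < t -> 0 <= rel_density t y.
Proof.
move=> t0; rewrite /rel_density.
have := ler_wpM2l (expR_ge0 y) (expR_ge1Dx (ln t - y)).
by rewrite -expRD subrKC lnK ?posrE//; lra.
Qed.

(** Nonnegativity for the parameter t e instead of t.  It makes e^f integrable
    as soon as the relative density is. *)
Lemma expR_le_rel_density (t y : R) : 0 < t ->
  expR y <= rel_density t y + t * (expR 1 - 1).
Proof.
move=> t0; have t0' : 0 < t * expR 1 by rewrite mulr_gt0 ?expR_gt0.
have := rel_density_ge0 y t0'.
by rewrite /rel_density lnM ?posrE ?expR_gt0// expRK; lra.
Qed.

(** The two sides differ by Z ln (Z / t) - Z + t >= 0, where Z is the integral of
    e^f. *)
Lemma ent_le_relative d (T : measurableType d) (nu : probability T R)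
    (f : T -> R) (t : R) :
  0 < t -> measurable_fun setT f -> bounded_from_below f ->
  (\int[nu]_x (rel_density t (f x))%:E < +oo)%E ->
  ent_defined nu (expR \o f) /\
  (ent nu (expR \o f) <= \int[nu]_x (rel_density t (f x))%:E)%E.
Proof.
move=> t0 mf [c cf] oo.
have me : measurable_fun setT (fun x => expR (f x)) by exact: measurableT_comp.
have mr : measurable_fun setT (fun x => rel_density t (f x)).
  apply: measurable_funD => //; apply: measurable_funB => //.
  by apply: measurable_funM => //; exact: measurable_funB.
have ir : nu.-integrable setT (EFin \o (fun x => rel_density t (f x))).
  apply/integrableP; split; first exact/measurable_EFinP.
  by under eq_integral do rewrite /= ger0_norm ?rel_density_ge0//.
have icst (k : R) : nu.-integrable setT (EFin \o (fun=> k)).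
  exact: finite_measure_integrable_cst.
have irk (k : R) : nu.-integrable setT
    (EFin \o (fun x => rel_density t (f x) + k)).
  exact: (integrableD measurableT ir (icst k)).
have ie : nu.-integrable setT (EFin \o (fun x => expR (f x))).
  apply: (le_integrable measurableT _ _ (irk (t * (expR 1 - 1)))).
    exact/measurable_EFinP.
  move=> x _ /=; rewrite lee_fin ger0_norm ?expR_ge0//.
  by apply: le_trans (expR_le_rel_density _ t0) (ler_norm _).
have iek : nu.-integrable setT (EFin \o (fun x => (ln t + 1) * expR (f x))).
  exact: (integrableZl measurableT (ln t + 1) ie).
have gE x : expR (f x) * ln (expR (f x)) =
    (rel_density t (f x) + - t) + (ln t + 1) * expR (f x).
  by rewrite expRK /rel_density; ring.
have ig : nu.-integrable setT (EFin \o (fun x => expR (f x) * ln (expR (f x)))).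
  under eq_fun do rewrite gE.
  exact: (integrableD measurableT (irk (- t)) iek).
have fineE (h : T -> R) : nu.-integrable setT (EFin \o h) ->
    (\int[nu]_x (h x)%:E = (\int[nu]_x h x)%R%:E)%E.
  move=> ih; rewrite /Rintegral fineK//.
  exact: (integrable_fin_num measurableT ih).
pose Z := (\int[nu]_x expR (f x))%R.
have Z0 : 0 < Z.
  apply: lt_le_trans (expR_gt0 c) _.
  have -> : expR c = (\int[nu]_x expR c)%R.
    by rewrite Rintegral_cst// [X in fine X](@probability_setT _ _ _ nu) mulr1.
  by apply: le_Rintegral => // x _; rewrite ler_expR.
rewrite /ent_defined /ent (fineE _ ig) (fineE _ ie) (fineE _ ir) -/Z.
rewrite lne_EFin// -EFinM; split => //; rewrite -EFinB lee_fin.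
have -> : (\int[nu]_x (expR (f x) * ln (expR (f x))) =
    \int[nu]_x rel_density t (f x) - t + (ln t + 1) * Z)%R.
  under eq_Rintegral do rewrite gE.
  rewrite (RintegralD measurableT (irk (- t)) iek).
  rewrite (RintegralD measurableT ir (icst (- t))) (RintegralZl _ measurableT ie).
  by rewrite Rintegral_cst// [X in fine X](@probability_setT _ _ _ nu) mulr1.
have := rel_density_ge0 (ln Z) t0; rewrite /rel_density lnK ?posrE//; lra.
Qed.

End relative_entropy.

Section mixture.
Context (R : realType) (d : nat) (dT : measure_display)
  (Theta : measurableType dT) (m : probability Theta R)
  (mu : Theta -> probability 'rV[R]_d R) (mumix : probability 'rV[R]_d R).
Hypothesis hmix : is_mixture m mu mumix.
Hypothesis hexp : forall t, exponential_moments (mu t).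

Lemma integral_mumix (h : 'rV[R]_d -> R) : continuous h -> (forall x, 0 <= h x) ->
  (\int[mumix]_x (h x)%:E = \int[m]_t \int[mu t]_x (h x)%:E)%E.
Proof.
move=> ch h0; apply: (@integral_mixture _ _ _ _ _ m mu mumix).
- exact: hmix.1.
- exact: hmix.2.
- by apply/measurable_EFinP; exact: continuous_measurable.
- by move=> x; rewrite lee_fin.
Qed.

Lemma measurable_integral_mu (h : 'rV[R]_d -> R) :
  continuous h -> (forall x, 0 <= h x) ->
  measurable_fun setT (fun t => (\int[mu t]_x (h x)%:E)%E).
Proof.
move=> ch h0; apply: (@measurable_fun_integral_kernel _ _ _ _ _ mu).
- exact: hmix.1.
- by move=> x; rewrite lee_fin.
- by apply/measurable_EFinP; exact: continuous_measurable.
Qed.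

Lemma mixing_space_inhabited : exists t : Theta, True.
Proof.
apply/not_existsP => noT; have := probability_setT m.
rewrite (_ : setT = set0) ?measure0.
  by move/eqP; rewrite eqe eq_sym oner_eq0.
by apply/seteqP; split => // t; have := noT t.
Qed.

(** The parameter of the relative density is the infimum b of the integrals of
    e^f over the family, so that a lower bound valid for every component is a
    lower bound for b. *)
Lemma convex_LSI_mixture (C D N : R) : C <= N / 4 -> D <= N / 8 ->
  (forall t, convex_LSI (mu t) C) ->
  (forall t t', (weak_transport_cost (mu t) (mu t') < D%:E)%E) ->
  convex_LSI mumix (2 * N).
Proof.
move=> CN DN lsi cost; have [th0 _] := mixing_space_inhabited.
have C0 : 0 < C by case: (lsi th0).
have N0 : 0 < N by lra.
split => [|f cf f1 fl fb]; first by rewrite mulr_gt0.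
have [L fpL] := C1_tame cf f1 fl fb.
rewrite /= mulrAC divff// mul1r.
set p := gradient f in fpL *.
set I := (\int[mumix]_x _)%E => Ioo.
pose F t := expint (mu t) f.
have [c cfx] := fb.
have Fc t : expR c <= F t.
  rewrite -[leLHS](Rint_cst (mu t)); apply: Rint_le => //.
  - exact: expgrowth_cst.
  - exact: tame_expgrowth_expR fpL.
  - by move=> x; rewrite ler_expR.
pose b := inf (range F).
have rF0 : range F !=set0 by exists (F th0), th0.
have b0 : 0 < b.
  apply: lt_le_trans (expR_gt0 c) _; apply: lb_le_inf => // _ [t _ <-].
  exact: Fc.
have bF t : b <= F t.
  by apply: ge_inf; [exists (expR c) => _ [t' _ <-]; exact: Fc|exists t].
pose phi x := rel_density b (f x).
have phi0 x : 0 <= phi x := rel_density_ge0 (f x) b0.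
have ge := tame_expgrowth_expR fpL.
have gpe := expgrowthM (tame_expgrowth_slope fpL) ge.
have gphi : expgrowth phi.
  apply: expgrowthD; last exact: expgrowth_cst.
  have gN : expgrowth (fun x => - expR (f x)).
    by under eq_fun do rewrite -mulN1r; exact: expgrowthZ.
  apply: expgrowthD gN; apply: expgrowthM => //.
  by apply: expgrowthD; [exact: tame_expgrowth fpL|exact: expgrowth_cst].
have e0 x : 0 <= enorm (p x) ^+ 2 * expR (f x).
  by rewrite mulr_ge0 ?sqr_ge0 ?expR_ge0.
have phiI : (\int[mumix]_x (phi x)%:E <= N%:E * I)%E.
  rewrite (integral_mumix gphi.1 phi0) /I (integral_mumix gpe.1 e0).
  have mI := measurable_integral_mu gpe.1 e0.
  have I0 t : (0 <= \int[mu t]_x (enorm (p x) ^+ 2 * expR (f x))%:E)%E.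
    by apply: integral_ge0 => x _; rewrite lee_fin.
  rewrite -(ge0_integralZl_EFin m measurableT _ mI) ?(ltW N0)//.
  apply: ge0_le_integral => //.
  - by move=> t _; apply: integral_ge0 => x _; rewrite lee_fin.
  - exact: measurable_integral_mu gphi.1 phi0.
  - exact: measurable_funeM.
  move=> t _; rewrite (EFin_Rint (hexp t) gphi) (EFin_Rint (hexp t) gpe).
  rewrite -EFinM lee_fin.
  apply: (relative_entropy_le (hexp t) (lsi t) CN fpL b0 (bF t)).
  move=> u u0 eu; apply: lb_le_inf => // _ [t' _ <-].
  exact: (compare_mass (hexp t) (lsi t) CN DN fpL (hexp t') (cost t' t) u0 eu).
have mf := continuous_measurable (tame_continuous fpL).
have [dfn le] := ent_le_relative b0 mf fb (le_lt_trans phiI Ioo).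
by split => //; exact: le_trans le phiI.
Qed.

End mixture.

Local Open Scope ereal_scope.

Lemma C_LS_conv_ge0 (R : realType) (d : nat) (nu : probability 'rV[R]_d R) :
  0 <= C_LS_conv nu.
Proof. by apply: le_ereal_inf_tmp => _ [C [C0 _] <-]; rewrite lee_fin ltW. Qed.

Lemma convex_LSI_gt_C_LS_conv (R : realType) (d : nat)
    (nu : probability 'rV[R]_d R) (C : R) :
  C_LS_conv nu < C%:E -> convex_LSI nu C.
Proof.
move=> /ereal_inf_lt[_ [C' lsi <-]]; rewrite lte_fin => /ltW.
exact: convex_LSI_le.
Qed.

Lemma weak_transport_cost_ge0 (R : realType) (d : nat)
    (mu2 mu1 : probability 'rV[R]_d R) : 0 <= weak_transport_cost mu2 mu1.
Proof.
apply: le_ereal_inf_tmp => _ [pi [p [_ _ ->]]].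
by apply: integral_ge0 => x _; rewrite lee_fin mulr_ge0// sqr_ge0.
Qed.

Theorem corollary2p7 (R : realType) (d : nat)
    (dT : measure_display) (Theta : measurableType dT)
    (m : probability Theta R)
    (mu : Theta -> probability 'rV[R]_d R)
    (mumix : probability 'rV[R]_d R)
    (hmix : is_mixture m mu mumix)
    (C_Theta D_Theta : \bar R)
    (hC : C_Theta = ereal_sup [set C_LS_conv (mu t) | t in setT])
    (hCfin : C_Theta < +oo)
    (hexp : forall (t : Theta) (s : R), (0 < s)%R ->
      \int[mu t]_x (expR (s * enorm x))%:E < +oo)
    (hD : D_Theta = ereal_sup
      [set weak_transport_cost (mu tt'.1) (mu tt'.2) | tt' in setT])
    (hDfin : D_Theta < +oo) :
  (exists C : R, convex_LSI mumix C) /\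
  C_LS_conv mumix <= maxe (8%:E * C_Theta) (16%:E * D_Theta).
Proof.
have [th0 _] := mixing_space_inhabited m.
have Cle t : C_LS_conv (mu t) <= C_Theta.
  by rewrite hC; apply: ereal_sup_ubound; exists t.
have Dle t t' : weak_transport_cost (mu t) (mu t') <= D_Theta.
  by rewrite hD; apply: ereal_sup_ubound; exists (t, t').
have C0 : 0 <= C_Theta := le_trans (C_LS_conv_ge0 (mu th0)) (Cle th0).
have D0 : 0 <= D_Theta :=
  le_trans (weak_transport_cost_ge0 (mu th0) (mu th0)) (Dle th0 th0).
have [c cE] : exists c, C_Theta = c%:E.
  by exists (fine C_Theta); rewrite fineK// ge0_fin_numE.
have [e eE] : exists e, D_Theta = e%:E.
  by exists (fine D_Theta); rewrite fineK// ge0_fin_numE.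
pose K := (Num.max (8 * c) (16 * e))%R.
have lsimix (eps : R) : (0 < eps)%R -> convex_LSI mumix (K + eps).
  move=> eps0; have -> : (K + eps = 2 * ((K + eps) / 2))%R by lra.
  have [K8 K16] : (8 * c <= K /\ 16 * e <= K)%R.
    by split; rewrite /K le_max lexx ?orbT.
  apply: (@convex_LSI_mixture _ _ _ _ _ _ _ hmix hexp (c + eps / 8) (e + eps / 16)).
  - lra.
  - lra.
  - move=> t; apply: convex_LSI_gt_C_LS_conv; apply: le_lt_trans (Cle t) _.
    by rewrite cE lte_fin ltrDl divr_gt0.
  - move=> t t'; apply: le_lt_trans (Dle t t') _.
    by rewrite eE lte_fin ltrDl divr_gt0.
split; first by exists (K + 1)%R; exact: lsimix.
rewrite cE eE -!EFinM -EFin_max -/K; apply/lee_addgt0Pr => eps eps0.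
by apply: ereal_inf_lbound; exists (K + eps)%R => //; exact: lsimix.
Qed.
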